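(* Let $A$ be a $C^*$-algebra and let $\tau: A^+\to[0,\infty]$ be a densely defined trace on $A$. Then $$K_0(A^\dagger) = \left\{ [e]-[f] : e,f\in P_\infty(\mathcal M_\tau^\dagger)\right\}$$ and there is a group homomorphism $\tau^\dagger_* : K_0(A^\dagger)\to\mathbb R$ such that $$\tau^\dagger_*([e]-[f]) = (\tau^\dagger\otimes \operatorname{Tr}_n)(e) - (\tau^\dagger\otimes \operatorname{Tr}_n)(f)$$ for all $n \in \mathbb N$ and all projections $e,f\in M_n(\mathcal M_\tau^\dagger)$.
   Context: Let $A$ be a $C^*$-algebra with positive cone $A^+$. A weight on $A$ is a map $\psi : A^+ \to [0,\infty]$ with $\psi(a+b)=\psi(a)+\psi(b)$ and $\psi(ta)=t\psi(a)$ for all $a,b\in A^+$ and real $t\ge 0$, with the convention $0\cdot\infty=0$. It is densely defined when $\{a\in A^+ : \psi(a)<\infty\}$ is dense in $A^+$, and a trace when $\psi(aa^* )=\psi(a^*a)$ for all $a\in A$. No lower semi-continuity is assumed. For a weight $\tau$, let $\mathcal M_\tau^+=\{a\in A^+:\tau(a)<\infty\}$ and $\mathcal M_\tau=\operatorname{Span}\mathcal M_\tau^+$. It is known that $\mathcal M_\tau$ is a $*$-subalgebra of $A$, $\mathcal M_\tau\cap A^+=\mathcal M_\tau^+$, and $\tau$ on $\mathcal M_\tau^+$ extends uniquely to a linear map $\tau|_{\mathcal M_\tau}:\mathcal M_\tau\to\mathbb C$. $A^\dagger$ is the unital $C^*$-algebra obtained by adjoining a unit to $A$ (also when $A$ is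 already unital): as a vector space $A^\dagger=A\oplus\mathbb C$, with $(a,\lambda)(b,\mu)=(ab+\lambda b+\mu a,\lambda\mu)$ and $(a,\lambda)^*=(a^*,\overline\lambda)$. Set $\mathcal M_\tau^\dagger=\{(a,\lambda)\in A^\dagger: a\in\mathcal M_\tau,\ \lambda\in\mathbb C\}$ and define the linear map $\tau^\dagger:\mathcal M_\tau^\dagger\to\mathbb C$ by $\tau^\dagger(a,\lambda)=\tau|_{\mathcal M_\tau}(a)$. The map $\tau^\dagger\otimes\operatorname{Tr}_n:M_n(\mathcal M_\tau^\dagger)\to\mathbb C$ is $x=(x_{ij})\mapsto\sum_{i=1}^n\tau^\dagger(x_{ii})$. $P_n(\mathcal M_\tau^\dagger)$ is the set of projections in the $*$-algebra $M_n(\mathcal M_\tau^\dagger)$ and $P_\infty(\mathcal M_\tau^\dagger)=\bigcup_nP_n(\mathcal M_\tau^\dagger)$, where matrices are embedded in larger ones by adding zero rows and columns. Since $A^\dagger$ is unital, $K_0(A^\dagger)$ is the Grothendieck group of the abelian semigroup of Murray–von Neumann equivalence classes $[e]$ of projections $e\in\bigcup_nM_n(A^\dagger)$, where $p\sim q$ means $vv^*=p$, $v^*v=q$ for some $v\in\bigcup_nM_n(A^\dagger)$, with addition induced by orthogonal sums; $[e]$ also denotes the corresponding element of $K_0(A^\dagger)$. *)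

(* Defs.v *)
From HB Require Import structures.
From mathcomp Require Import all_boot all_order all_algebra generic_quotient.
From mathcomp Require Import complex.
From mathcomp Require Import all_classical all_reals all_analysis.

Set Implicit Arguments.
Unset Strict Implicit.
Unset Printing Implicit Defensive.

Import Order.TTheory GRing.Theory Num.Theory.
Import numFieldNormedType.Exports.
Local Open Scope ring_scope.
Local Open Scope complex_scope.
Local Open Scope classical_set_scope.
Local Open Scope quotient_scope.

HB.mixin Record hasStar V of GRing.Zmodule V := {
  star : V -> V;
  starK : involutive star;
  starD : {morph star : x y / x + y}
}.

#[short(type="starZmodType")]
HB.structure Definition StarZmodule := {V of GRing.Zmodule V & hasStar V}.

HB.mixin Record StarZmodule_isStarRing B of GRing.NzRing B & hasStar B := {
  starM : forall x y : B, star (x * y) = star y * star x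
}.

#[short(type="starRingType")]
HB.structure Definition StarRing :=
  {B of GRing.NzRing B & hasStar B & StarZmodule_isStarRing B}.

(* The product is a new operation: MathComp rings are unital, C*-algebras need
   not be. The norm of a normed module over R[i] takes its values in R[i]. *)
HB.mixin Record isCStarAlgebra (R : realType) A
    of CompleteNormedModule R[i] A & hasStar A := {
  cmul : A -> A -> A;
  cmulA : associative cmul;
  cmulDl : left_distributive cmul +%R;
  cmulDr : right_distributive cmul +%R;
  cmulZl : forall (c : R[i]) (x y : A), cmul (c *: x) y = c *: cmul x y;
  cmulZr : forall (c : R[i]) (x y : A), cmul x (c *: y) = c *: cmul x y;
  starZ : forall (c : R[i]) (x : A), star (c *: x) = (conjc c) *: star x;
  star_cmul : forall x y : A, star (cmul x y) = cmul (star y) (star x);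
  normr_cmul : forall x y : A, `|cmul x y| <= `|x| * `|y|;
  normr_cstar : forall x : A, `|cmul (star x) x| = `|x| ^+ 2
}.

#[short(type="cstarAlgType")]
HB.structure Definition CStarAlgebra (R : realType) :=
  {A of CompleteNormedModule R[i] A & hasStar A & isCStarAlgebra R A}.

Section CStarTheory.
Context {R : realType} {A : cstarAlgType R}.
Implicit Types x y : A.

Lemma cmul0l x : cmul 0 x = 0.
Proof. by apply: (addrI (cmul 0 x)); rewrite -cmulDl !addr0. Qed.

Lemma cmul0r x : cmul x 0 = 0.
Proof. by apply: (addrI (cmul x 0)); rewrite -cmulDr !addr0. Qed.

End CStarTheory.

Lemma star0 (V : starZmodType) : star (0 : V) = 0.
Proof. by apply: (addrI (star 0)); rewrite -starD !addr0. Qed.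

Definition unitization (R : realType) (A : cstarAlgType R) : Type :=
  (A * R[i])%type.

Section Unitization.
Context {R : realType} {A : cstarAlgType R}.
Local Notation Ad := (unitization A).

HB.instance Definition _ := GRing.Zmodule.copy Ad (A * R[i])%type.

Definition unitz_one : Ad := (0, 1).
Definition unitz_mul (x y : Ad) : Ad :=
  (cmul x.1 y.1 + x.2 *: y.1 + y.2 *: x.1, x.2 * y.2).
Definition unitz_star (x : Ad) : Ad := (star x.1, conjc x.2).

Lemma unitz_mulA : associative unitz_mul.
Proof.
move=> [a l] [b m] [c n]; rewrite /unitz_mul/=; congr pair; last by rewrite mulrA.
rewrite !cmulDl !cmulDr !cmulZl !cmulZr !scalerDr !scalerA cmulA !addrA.
by rewrite [n * l]mulrC [n * m]mulrC [LHS](ACl (1*4*2*5*3*6*7)%AC).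
Qed.

Lemma unitz_mul1 : left_id unitz_one unitz_mul.
Proof.
by move=> [a l]; rewrite /unitz_mul/= cmul0l scaler0 addr0 scale1r add0r mul1r.
Qed.

Lemma unitz_mulr1 : right_id unitz_one unitz_mul.
Proof.
by move=> [a l]; rewrite /unitz_mul/= cmul0r scaler0 addr0 scale1r add0r mulr1.
Qed.

Lemma unitz_mulDl : left_distributive unitz_mul +%R.
Proof.
move=> [a l] [b m] [c n]; rewrite /unitz_mul; congr pair => /=; last exact: mulrDl.
by rewrite cmulDl scalerDl scalerDr !addrA [LHS](ACl (1*3*5*2*4*6)%AC).
Qed.

Lemma unitz_mulDr : right_distributive unitz_mul +%R.
Proof.
move=> [a l] [b m] [c n]; rewrite /unitz_mul; congr pair => /=; last exact: mulrDr.
by rewrite cmulDr scalerDl scalerDr !addrA [LHS](ACl (1*3*5*2*4*6)%AC).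
Qed.

Lemma unitz_oner_neq0 : unitz_one != 0.
Proof. by apply/eqP => -[] /eqP; rewrite oner_eq0. Qed.

HB.instance Definition _ := GRing.Zmodule_isNzRing.Build Ad
  unitz_mulA unitz_mul1 unitz_mulr1 unitz_mulDl unitz_mulDr unitz_oner_neq0.

Lemma unitz_starK : involutive unitz_star.
Proof. by move=> [a l]; rewrite /unitz_star/= starK conjcK. Qed.

Lemma unitz_starD : {morph unitz_star : x y / x + y}.
Proof.
by move=> [a l] [b m]; congr pair; [exact: starD | exact: (rmorphD (@conjc R))].
Qed.

HB.instance Definition _ := hasStar.Build Ad unitz_starK unitz_starD.

Lemma unitz_starM (x y : Ad) : star (x * y) = star y * star x.
Proof.
case: x y => [a l] [b m]; congr pair => /=.
  by rewrite !starD star_cmul !starZ -!addrA; congr (_ + _); rewrite addrC.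
by rewrite rmorphM mulrC.
Qed.

HB.instance Definition _ := StarZmodule_isStarRing.Build Ad unitz_starM.

End Unitization.

Section Adjoint.
Context {B : starRingType}.

Definition madj m n (x : 'M[B]_(m, n)) : 'M[B]_(n, m) := (map_mx star x)^T.

Lemma madjK m n (x : 'M[B]_(m, n)) : madj (madj x) = x.
Proof. by apply/matrixP => i j; rewrite !mxE starK. Qed.

Lemma star_sum (I : Type) (r : seq I) (P : pred I) (F : I -> B) :
  star (\sum_(i <- r | P i) F i) = \sum_(i <- r | P i) star (F i).
Proof. by apply: (big_morph _ (@starD B)); exact: star0. Qed.

Lemma star1 : star (1 : B) = 1.
Proof. by rewrite -[LHS]mulr1 -{2}[1]starK -starM mulr1 starK. Qed.

Lemma madjM m n p (x : 'M[B]_(m, n)) (y : 'M[B]_(n, p)) :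
  madj (x *m y) = madj y *m madj x.
Proof.
apply/matrixP => i j; rewrite !mxE star_sum.
by apply: eq_bigr => k _; rewrite !mxE starM.
Qed.

Lemma madj0 m n : madj (0 : 'M[B]_(m, n)) = 0.
Proof. by apply/matrixP => i j; rewrite !mxE star0. Qed.

Lemma madj_pid m n r : madj (pid_mx r : 'M[B]_(m, n)) = pid_mx r.
Proof.
rewrite -[RHS]tr_pid_mx; apply: (congr1 trmx); apply/matrixP => i j.
rewrite !mxE.
by case: (_ && _); rewrite ?star1 ?star0.
Qed.

Lemma madj_row m n1 n2 (x : 'M[B]_(m, n1)) (y : 'M[B]_(m, n2)) :
  madj (row_mx x y) = col_mx (madj x) (madj y).
Proof. by rewrite /madj map_row_mx tr_row_mx. Qed.

Lemma madj_block m1 m2 n1 n2 (x : 'M[B]_(m1, n1)) (y : 'M[B]_(m1, n2))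
    (z : 'M[B]_(m2, n1)) (t : 'M[B]_(m2, n2)) :
  madj (block_mx x y z t) = block_mx (madj x) (madj z) (madj y) (madj t).
Proof. by rewrite /madj map_block_mx tr_block_mx. Qed.

Definition is_proj n (p : 'M[B]_n) : bool := (p *m p == p) && (madj p == p).

(* For m <= k this is the corner embedding M_m -> M_k, adding zero rows and
   columns. *)
Definition mpad m k (x : 'M[B]_m) : 'M[B]_k :=
  (pid_mx m : 'M[B]_(k, m)) *m x *m (pid_mx m : 'M[B]_(m, k)).

Definition mvn m n (p : 'M[B]_m) (q : 'M[B]_n) : Prop :=
  exists k (v : 'M[B]_k), [/\ (m <= k)%N, (n <= k)%N,
    v *m madj v = mpad k p & madj v *m v = mpad k q].

Lemma mvnP m n (p : 'M[B]_m) (q : 'M[B]_n) : is_proj p -> is_proj q ->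
  mvn p q <-> exists w : 'M[B]_(m, n), w *m madj w = p /\ madj w *m w = q.
Proof.
move=> /andP[/eqP pp /eqP ps] /andP[/eqP qq /eqP qs]; split.
- move=> [k [v [mk nk vp vq]]].
  pose J l : 'M[B]_(l, k) := pid_mx l.
  have JJ l : (l <= k)%N -> J l *m madj (J l) = 1%:M.
    by move=> lk; rewrite madj_pid pid_mx_id// pid_mx_1.
  have vp' : v *m madj v = madj (J m) *m p *m J m by rewrite vp madj_pid.
  have vq' : madj v *m v = madj (J n) *m q *m J n by rewrite vq madj_pid.
  exists (p *m J m *m v *m madj (J n) *m q).
  rewrite !madjM !madjK ps qs; split.
    have -> : p *m J m *m v *m madj (J n) *m q *m
        (q *m (J n *m (madj v *m (madj (J m) *m p)))) =
        p *m J m *m (v *m (madj (J n) *m (q *m q) *m J n) *m madj v)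
          *m madj (J m) *m p by rewrite !mulmxA.
    rewrite qq -vq'.
    have -> : v *m (madj v *m v) *m madj v =
        (v *m madj v) *m (v *m madj v) by rewrite !mulmxA.
    rewrite vp'.
    have -> : madj (J m) *m p *m J m *m (madj (J m) *m p *m J m) =
       madj (J m) *m p *m (J m *m madj (J m)) *m p *m J m by rewrite !mulmxA.
    rewrite JJ// mulmx1 -(mulmxA _ p p) pp.
    have -> : p *m J m *m (madj (J m) *m p *m J m) *m madj (J m) *m p =
       p *m (J m *m madj (J m)) *m p *m (J m *m madj (J m)) *m p
       by rewrite !mulmxA.
    by rewrite JJ// !mulmx1 !pp.
  have -> : q *m (J n *m (madj v *m (madj (J m) *m p))) *m
      (p *m J m *m v *m madj (J n) *m q) =
      q *m J n *m (madj v *m (madj (J m) *m (p *m p) *m J m) *m v)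
        *m madj (J n) *m q by rewrite !mulmxA.
  rewrite pp -vp'.
  have -> : madj v *m (v *m madj v) *m v =
      (madj v *m v) *m (madj v *m v) by rewrite !mulmxA.
  rewrite vq'.
  have -> : madj (J n) *m q *m J n *m (madj (J n) *m q *m J n) =
     madj (J n) *m q *m (J n *m madj (J n)) *m q *m J n by rewrite !mulmxA.
  rewrite JJ// mulmx1 -(mulmxA _ q q) qq.
  have -> : q *m J n *m (madj (J n) *m q *m J n) *m madj (J n) *m q =
     q *m (J n *m madj (J n)) *m q *m (J n *m madj (J n)) *m q
     by rewrite !mulmxA.
  by rewrite JJ// !mulmx1 !qq.
- move=> [w [wp wq]]; pose k := maxn m n.
  have [mk nk] : (m <= k)%N /\ (n <= k)%N by rewrite leq_maxl leq_maxr.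
  exists k, ((pid_mx m : 'M[B]_(k, m)) *m w *m (pid_mx n : 'M[B]_(n, k))).
  have JJ l : (l <= k)%N ->
      (pid_mx l : 'M[B]_(l, k)) *m (pid_mx l : 'M[B]_(k, l)) = 1%:M.
    by move=> lk; rewrite pid_mx_id// pid_mx_1.
  have mulA5 a b c d (P : 'M[B]_(k, a)) (x : 'M[B]_(a, b)) (Q : 'M[B]_(b, k))
      (Q' : 'M[B]_(k, b)) (y : 'M[B]_(b, c)) (P' : 'M[B]_(c, d)) :
      P *m x *m Q *m (Q' *m (y *m P')) = P *m (x *m (Q *m Q') *m y) *m P'.
    by rewrite !mulmxA.
  rewrite !madjM !madj_pid /mpad; split=> //.
    by rewrite mulA5 JJ// mulmx1 wp.
  by rewrite [X in X *m _]mulmxA -(mulmxA _ w) mulA5 JJ// mulmx1 wq.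
Qed.

Lemma is_proj0 n : is_proj (0 : 'M[B]_n).
Proof. by rewrite /is_proj mulmx0 madj0 !eqxx. Qed.

Definition dsum m n (p : 'M[B]_m) (q : 'M[B]_n) : 'M[B]_(m + n) :=
  block_mx p 0 0 q.

Lemma is_proj_dsum m n (p : 'M[B]_m) (q : 'M[B]_n) :
  is_proj p -> is_proj q -> is_proj (dsum p q).
Proof.
move=> /andP[/eqP pp /eqP ps] /andP[/eqP qq /eqP qs].
rewrite /is_proj /dsum mulmx_block madj_block !madj0 ps qs pp qq.
by rewrite !mulmx0 !mul0mx !addr0 add0r !eqxx.
Qed.

End Adjoint.

Section K0.
Context {B : starRingType}.

(* The disjoint union over n of the sets of projections of M_n(B). *)
Definition projections := {n : nat & {p : 'M[B]_n | is_proj p}}.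

Definition Projection n (p : 'M[B]_n) (hp : is_proj p) : projections :=
  existT _ n (exist _ p hp).

Definition proj_size (x : projections) : nat := tag x.
Definition proj_mx (x : projections) : 'M[B]_(proj_size x) := val (tagged x).

Lemma proj_mxP (x : projections) : is_proj (proj_mx x).
Proof. exact: valP (tagged x). Qed.

Definition proj_mvn (x y : projections) : bool :=
  `[< mvn (proj_mx x) (proj_mx y) >].

Lemma proj_mvnP (x y : projections) : reflect
  (exists w : 'M[B]_(proj_size x, proj_size y),
     w *m madj w = proj_mx x /\ madj w *m w = proj_mx y) (proj_mvn x y).
Proof.
apply: (iffP (asboolP _)); first by move/mvnP; apply; exact: proj_mxP.
by move=> ?; apply/mvnP => //; exact: proj_mxP.
Qed.

Lemma proj_mvn_refl : reflexive proj_mvn.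
Proof.
move=> x; apply/proj_mvnP; exists (proj_mx x).
by have /andP[/eqP pp /eqP ps] := proj_mxP x; rewrite ps.
Qed.

Lemma proj_mvn_sym : symmetric proj_mvn.
Proof.
suff h x y : proj_mvn x y -> proj_mvn y x by move=> x y; apply/idP/idP; exact: h.
by move=> /proj_mvnP[w [h1 h2]]; apply/proj_mvnP; exists (madj w); rewrite madjK.
Qed.

Lemma proj_mvn_trans : transitive proj_mvn.
Proof.
move=> y x z /proj_mvnP[v [v1 v2]] /proj_mvnP[w [w1 w2]].
apply/proj_mvnP; exists (v *m w); rewrite madjM; split.
  have -> : v *m w *m (madj w *m madj v) = v *m (w *m madj w) *m madj v.
    by rewrite !mulmxA.
  rewrite w1 -v2.
  have -> : v *m (madj v *m v) *m madj v = (v *m madj v) *m (v *m madj v).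
    by rewrite !mulmxA.
  by rewrite v1; have /andP[/eqP] := proj_mxP x.
have -> : madj w *m madj v *m (v *m w) = madj w *m (madj v *m v) *m w.
  by rewrite !mulmxA.
rewrite v2 -w1.
have -> : madj w *m (w *m madj w) *m w = (madj w *m w) *m (madj w *m w).
  by rewrite !mulmxA.
by rewrite w2; have /andP[/eqP] := proj_mxP z.
Qed.

Canonical proj_mvn_equiv :=
  EquivRel proj_mvn proj_mvn_refl proj_mvn_sym proj_mvn_trans.

Definition proj_add (x y : projections) : projections :=
  Projection (is_proj_dsum (proj_mxP x) (proj_mxP y)).

Definition proj_zero : projections := Projection (is_proj0 0).

Lemma proj_add_mvn (x x' y y' : projections) :
  proj_mvn x x' -> proj_mvn y y' -> proj_mvn (proj_add x y) (proj_add x' y').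
Proof.
move=> /proj_mvnP[v [v1 v2]] /proj_mvnP[w [w1 w2]].
apply/proj_mvnP; exists (block_mx v 0 0 w); rewrite madj_block !madj0.
rewrite !mulmx_block !mulmx0 !mul0mx !addr0 !add0r.
by split; congr block_mx.
Qed.

Lemma proj_addC_mvn (x y : projections) :
  proj_mvn (proj_add x y) (proj_add y x).
Proof.
have /andP[/eqP xx /eqP xs] := proj_mxP x.
have /andP[/eqP yy /eqP ys] := proj_mxP y.
apply/proj_mvnP; exists (block_mx 0 (proj_mx x) (proj_mx y) 0).
rewrite madj_block !madj0 !mulmx_block !mulmx0 !mul0mx !addr0 !add0r xs ys.
by rewrite xx yy.
Qed.

Lemma proj_add0_mvn (x : projections) : proj_mvn (proj_add proj_zero x) x.
Proof.
have /andP[/eqP xx /eqP xs] := proj_mxP x.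
apply/proj_mvnP; exists (col_mx 0 (proj_mx x)).
have -> : madj (col_mx (0 : 'M[B]_(0, _)) (proj_mx x)) = row_mx 0 (proj_mx x).
  apply: (can_inj (@madjK _ _ _)); rewrite madjK madj_row madj0; congr col_mx.
  by rewrite xs.
rewrite mul_row_col mul_col_row !mulmx0 !mul0mx add0r xx.
by split.
Qed.

Lemma cast_mvn m n (e : m = n) (p : 'M[B]_m) (q : 'M[B]_n) :
  is_proj p -> q = castmx (e, e) p ->
  exists w : 'M[B]_(m, n), w *m madj w = p /\ madj w *m w = q.
Proof.
case: n / e q => q /andP[/eqP pp /eqP ps]; rewrite castmx_id => ->.
by exists p; rewrite ps.
Qed.

Lemma proj_addA_mvn (x y z : projections) :
  proj_mvn (proj_add x (proj_add y z)) (proj_add (proj_add x y) z).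
Proof.
apply/proj_mvnP.
pose e : proj_size (proj_add x (proj_add y z)) =
         proj_size (proj_add (proj_add x y) z) := addnA _ _ _.
apply: (@cast_mvn _ _ e _ _ (proj_mxP _)); rewrite {}/e.
set p := proj_mx x; set q := proj_mx y; set r := proj_mx z.
change (dsum (dsum p q) r =
  castmx (addnA _ _ _, addnA _ _ _) (dsum p (dsum q r))).
have := @block_mxA B _ _ _ _ _ _ p 0 0 0 q 0 0 0 r.
rewrite /dsum !row_mx0 !col_mx0 /= => ->.
by rewrite castmx_comp castmx_id.
Qed.

(* The semigroup of Murray-von Neumann classes, with [p] + [q] = [diag(p, q)]. *)
Definition mvn_classes := {eq_quot proj_mvn}.

HB.instance Definition _ := Choice.on mvn_classes.
HB.instance Definition _ := EqQuotient.on mvn_classes.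

Definition mvn_zero : mvn_classes := \pi_mvn_classes proj_zero.
Definition mvn_add (a b : mvn_classes) : mvn_classes :=
  \pi_mvn_classes (proj_add (repr a) (repr b)).

Lemma mvn_addE x y :
  mvn_add (\pi_mvn_classes x) (\pi_mvn_classes y) =
  \pi_mvn_classes (proj_add x y).
Proof.
apply/eqmodP/proj_add_mvn; exact/eqmodP/(reprK (\pi_mvn_classes _)).
Qed.

Lemma mvn_addA : associative mvn_add.
Proof.
elim/quotW => x; elim/quotW => y; elim/quotW => z.
rewrite (mvn_addE y z) (mvn_addE x y) !mvn_addE.
by apply/eqmodP; exact: proj_addA_mvn.
Qed.

Lemma mvn_addC : commutative mvn_add.
Proof.
elim/quotW => x; elim/quotW => y; rewrite !mvn_addE.
by apply/eqmodP; exact: proj_addC_mvn.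
Qed.

Lemma mvn_add0 : left_id mvn_zero mvn_add.
Proof. elim/quotW => x; rewrite mvn_addE; by apply/eqmodP; exact: proj_add0_mvn. Qed.

HB.instance Definition _ :=
  GRing.isNmodule.Build mvn_classes mvn_addA mvn_addC mvn_add0.

End K0.

Arguments projections B : clear implicits.
Arguments mvn_classes B : clear implicits.

Section Grothendieck.
Context {V : nmodType}.
Implicit Types x y : V * V.

(* (a, b) stands for the formal difference a - b. *)
Definition groth_rel x y : bool :=
  `[< exists c, x.1 + y.2 + c = y.1 + x.2 + c >].

Lemma groth_rel_refl : reflexive groth_rel.
Proof. by move=> x; apply/asboolP; exists 0. Qed.

Lemma groth_rel_sym : symmetric groth_rel.
Proof.
by move=> x y; apply/asboolP/asboolP => -[c h]; exists c.
Qed.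

Lemma groth_rel_trans : transitive groth_rel.
Proof.
move=> y x z /asboolP[c h] /asboolP[d k]; apply/asboolP.
exists (y.1 + y.2 + c + d).
transitivity ((x.1 + y.2 + c) + (y.1 + z.2 + d)).
  by rewrite !addrA (ACl (1*4*5*3*2*6)%AC).
by rewrite h k !addrA (ACl (4*2*1*5*3*6)%AC).
Qed.

Canonical groth_equiv :=
  EquivRel groth_rel groth_rel_refl groth_rel_sym groth_rel_trans.

Definition grothendieck := {eq_quot groth_rel}.

HB.instance Definition _ := Choice.on grothendieck.
HB.instance Definition _ := EqQuotient.on grothendieck.

Definition groth_zero : grothendieck := \pi_grothendieck (0, 0).
Definition groth_add (a b : grothendieck) : grothendieck :=
  \pi_grothendieck (repr a + repr b).
Definition groth_opp (a : grothendieck) : grothendieck :=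
  \pi_grothendieck ((repr a).2, (repr a).1).

Lemma groth_addE x y :
  groth_add (\pi_grothendieck x) (\pi_grothendieck y) = \pi_grothendieck (x + y).
Proof.
have /eqmodP/asboolP[c hc] := reprK (\pi_grothendieck x).
have /eqmodP/asboolP[d hd] := reprK (\pi_grothendieck y).
apply/eqmodP/asboolP; exists (c + d) => /=.
set x' := repr _ in hc *; set y' := repr _ in hd *.
transitivity ((x'.1 + x.2 + c) + (y'.1 + y.2 + d)).
  by rewrite !addrA [RHS](ACl (1*4*2*5*3*6)%AC).
by rewrite hc hd !addrA [LHS](ACl (1*4*2*5*3*6)%AC).
Qed.

Lemma groth_oppE x :
  groth_opp (\pi_grothendieck x) = \pi_grothendieck (x.2, x.1).
Proof.
have /eqmodP/asboolP[c hc] := reprK (\pi_grothendieck x).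
apply/eqmodP/asboolP; exists c => /=.
by rewrite [X in X + c]addrC -hc [X in _ = X + c]addrC.
Qed.

Lemma groth_addA : associative groth_add.
Proof.
elim/quotW => x; elim/quotW => y; elim/quotW => z.
by rewrite (groth_addE y z) (groth_addE x y) !groth_addE addrA.
Qed.

Lemma groth_addC : commutative groth_add.
Proof. by elim/quotW => x; elim/quotW => y; rewrite !groth_addE addrC. Qed.

Lemma groth_add0 : left_id groth_zero groth_add.
Proof. by elim/quotW => x; rewrite groth_addE add0r. Qed.

Lemma groth_addN : left_inverse groth_zero groth_opp groth_add.
Proof.
elim/quotW => x; rewrite groth_oppE groth_addE.
by apply/eqmodP/asboolP; exists 0; rewrite /= !addr0 add0r addrC.
Qed.

HB.instance Definition _ := GRing.isZmodule.Build grothendieck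
  groth_addA groth_addC groth_add0 groth_addN.

Definition groth_class (v : V) : grothendieck := \pi_grothendieck (v, 0).

End Grothendieck.

Arguments grothendieck V : clear implicits.

Definition K0 (B : starRingType) : zmodType := grothendieck (mvn_classes B).

Definition K0_class (B : starRingType) (x : projections B) : K0 B :=
  groth_class (\pi_(mvn_classes B) x).

Section Weights.
Context {R : realType} {A : cstarAlgType R}.
Implicit Types (psi tau : A -> \bar R) (a b : A).

(* In a C*-algebra the elements of the form b^* b make up the positive cone. *)
Definition cstar_pos : set A := [set a | exists b, a = cmul (star b) b].

(* A weight is a function on the positive cone; we represent it by a function on
   A whose values outside the cone are never used. In \bar R, 0 * +oo = 0. *)
Record is_weight psi : Prop := {
  weight_ge0 : forall a, cstar_pos a -> (0 <= psi a)%E;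
  weightD : forall a b, cstar_pos a -> cstar_pos b ->
    psi (a + b) = (psi a + psi b)%E;
  weightZ : forall (t : R) a, 0 <= t -> cstar_pos a ->
    psi (t%:C *: a) = (t%:E * psi a)%E
}.

Definition is_trace psi : Prop :=
  is_weight psi /\ forall a, psi (cmul a (star a)) = psi (cmul (star a) a).

Definition finite_pos tau : set A := [set a | cstar_pos a /\ (tau a < +oo)%E].

Definition densely_defined psi : Prop :=
  cstar_pos `<=` closure (finite_pos psi).

Definition finite_span tau : set A := [set x | exists n (c : 'I_n -> R[i])
  (a : 'I_n -> A), (forall i, finite_pos tau (a i)) /\
  x = \sum_(i < n) c i *: a i].

Definition is_linear_ext tau (f : A -> R[i]) : Prop :=
  (forall a, finite_pos tau a -> f a = (fine (tau a))%:C) /\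
  (forall (c : R[i]) x y, finite_span tau x -> finite_span tau y ->
     f (c *: x + y) = c * f x + f y).

(* The linear map on finite_span tau extending tau; it is unique there, and its
   values elsewhere are never used. *)
Definition linear_ext tau : A -> R[i] := xget (fun=> 0) (is_linear_ext tau).

Definition unitz_span tau : set (unitization A) :=
  [set x | finite_span tau x.1].

Definition unitz_trace tau (x : unitization A) : R[i] := linear_ext tau x.1.

Definition unitz_trace_mx tau n (x : 'M[unitization A]_n) : R[i] :=
  \sum_(i < n) unitz_trace tau (x i i).

Definition mx_over_span tau n (x : 'M[unitization A]_n) : Prop :=
  forall i j, unitz_span tau (x i j).

Definition Pinfty tau : set (projections (unitization A)) :=
  [set e | mx_over_span tau (proj_mx e)].

End Weights.

(* Main.v *)
From Stdlib Require Ncring Ncring_tac.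
From HB Require Import structures.
From mathcomp Require Import all_boot all_order all_algebra generic_quotient.
From mathcomp Require Import ring lra complex.
From mathcomp Require Import all_classical all_reals all_analysis.
Require Import Defs.

Set Implicit Arguments.
Unset Strict Implicit.
Unset Printing Implicit Defensive.

Import Order.TTheory GRing.Theory Num.Theory.
Import numFieldNormedType.Exports.
Local Open Scope ring_scope.
Local Open Scope complex_scope.
Local Open Scope classical_set_scope.

(** The theorem holds because the elements of finite weight form an ideal.
    A trace takes the same value on [x x^*] and [x^* x], so the set of [x] with
    [tau (x^* x) < +oo] ([hilbert_schmidt]) is a self-adjoint two-sided ideal of
    the unitization [A^dagger]. By polarization the span [M_tau] of its products
    is a two-sided ideal as well, and the linear extension of [tau] satisfies
    [tau (a b) = tau (b a)] as soon as one factor lies in [M_tau]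
    ([span_ideal]). The ideal is dense ([span_dense]). For matrices this means:
    if [w] has entries in [M_tau] and [g] is a power series in [w] with constant
    term 1, then [g - 1 = w z] again has entries in [M_tau], although [M_tau] is
    not closed and the series has its sum in [M_n(A^dagger)] only. Hence
    [M_n(M_tau^dagger)] is stable under the functional calculus that is needed.

    Surjectivity. A projection [p] over [A^dagger] is approximated by a
    self-adjoint [x] over [M_tau^dagger] with the same scalar part. Then
    [x - x^2] is small with entries in [M_tau], and the spectral projection
    [1/2 + (x - 1/2) (4 (x - 1/2)^2)^(-1/2)] lies over [M_tau^dagger] and is close
    to [p] ([bn_projection_near]), so it is equivalent to [p] ([polar],
    [projection_mvn_span]).

    Invariance. If [w w^* = e] and [w^* w = f] with [e], [f] over
    [M_tau^dagger], then [w] is approximated by [x] over [M_tau^dagger], and the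
    polar part [W] of [e x f] lies over [M_tau^dagger], with [W W^* = e] and
    [W^* W = f] exactly. The trace property now gives equality of the traces of
    [e] and [f] ([unitz_trace_mx_mvn]), and the map on [K_0] follows from the
    universal property of the Grothendieck group.

    Before all this, the linear extension of [tau] has to exist. Additivity is
    known only for elements of the form [b^* b], so sums of such elements must be
    of this form again: this is Kaplansky's theorem that [b^* b] is positive
    ([upos_cstar]), which is proved with norm estimates and square roots given by
    convergent iterations, without spectra. *)

(** * Noncommutative ring identities *)

Section NoncommutativeRingTactic.
Variable B : pzRingType.

#[global] Instance pzRing_ops :
  @Ncring.Ring_ops B 0 1 +%R *%R (fun x y : B => x - y) -%R eq := {}.

#[global] Instance pzRing_ncring :
  @Ncring.Ring B 0 1 +%R *%R (fun x y : B => x - y) -%R eq pzRing_ops.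
Proof.
split.
- exact: _.
- by move=> x y -> a b ->.
- by move=> x y -> a b ->.
- by move=> x y -> a b ->.
- by move=> x y ->.
- exact: add0r.
- exact: addrC.
- exact: addrA.
- exact: mul1r.
- exact: mulr1.
- exact: mulrA.
- exact: mulrDl.
- by move=> x y z; exact: mulrDr.
- by [].
- exact: subrr.
Qed.

End NoncommutativeRingTactic.

Ltac ncring := Ncring_tac.non_commutative_ring.

(** * Square roots and inverses in Banach *-rings *)

Section BanachStarRing.
Context {R : realType} {B : pzRingType}.

(** Scalars enter only through halving, so [N] is required to be compatible with
    doubling and [h] stands for one half. This covers both [A^dagger] and the
    matrix rings over it. *)
Record banach_star (N : B -> R) (s : B -> B) (h : B) : Prop := {
  bn_D : forall x y, N (x + y) <= N x + N y;
  bn_opp : forall x, N (- x) = N x;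
  bn_M : forall x y, N (x * y) <= N x * N y;
  bn_double : forall x, N (x + x) = N x + N x;
  bn_eq0 : forall x, N x = 0 -> x = 0;
  bn_complete : forall u : nat -> B,
    (forall e, 0 < e -> exists n, forall p q, (n <= p)%N -> (n <= q)%N ->
       N (u p - u q) < e) ->
    exists l, forall e, 0 < e -> exists n, forall p, (n <= p)%N ->
       N (u p - l) < e;
  bn_halfE : h + h = 1;
  bn_starD : forall x y, s (x + y) = s x + s y;
  bn_starM : forall x y, s (x * y) = s y * s x;
  bn_starK : forall x, s (s x) = x;
  bn_star : forall x, N (s x) = N x
}.

Variables (N : B -> R) (s : B -> B) (h : B).
Hypothesis NB : banach_star N s h.

Definition bn_lim (u : nat -> B) (l : B) : Prop :=
  forall e, 0 < e -> exists n, forall p, (n <= p)%N -> N (u p - l) < e.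

Lemma bn_0 : N 0 = 0.
Proof. by have := bn_double NB 0; rewrite addr0; lra. Qed.

Lemma bn_ge0 x : 0 <= N x.
Proof. by have := bn_D NB x (- x); rewrite subrr bn_0 (bn_opp NB); lra. Qed.

Lemma bn_B x y : N (x - y) <= N x + N y.
Proof. by rewrite -(bn_opp NB y); exact: (bn_D NB). Qed.

Lemma bn_distC x y : N (x - y) = N (y - x).
Proof. by rewrite -(bn_opp NB) opprB. Qed.

Lemma bn_dist x y z : N (x - z) <= N (x - y) + N (y - z).
Proof.
have -> : x - z = (x - y) + (y - z) by ncring.
exact: (bn_D NB).
Qed.

Lemma bn_half x : N (h * x) = N x / 2.
Proof.
have := bn_double NB (h * x); rewrite -mulrDl (bn_halfE NB) mul1r => ->; lra.
Qed.

Lemma bn_star0 : s 0 = 0.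
Proof. by apply: (addrI (s 0)); rewrite -(bn_starD NB) !addr0. Qed.

Lemma bn_starN x : s (- x) = - s x.
Proof.
by apply: (addIr (s x)); rewrite -(bn_starD NB) !addNr bn_star0.
Qed.

Lemma bn_star1 : s 1 = 1.
Proof. by rewrite -[LHS]mul1r -{1}(bn_starK NB 1) -(bn_starM NB) mul1r (bn_starK NB). Qed.

Lemma bn_halfC x : h * x = x * h.
Proof.
have e : (h + h) * x = x * (h + h) by rewrite (bn_halfE NB) mul1r mulr1.
rewrite -[h * x]mul1r -[x * h]mul1r -(bn_halfE NB).
have -> : (h + h) * (h * x) = h * ((h + h) * x) by ncring.
by rewrite e; ncring.
Qed.

Lemma bn_star_half : s h = h.
Proof.
have e : s h + s h = 1 by rewrite -(bn_starD NB) (bn_halfE NB) bn_star1.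
rewrite -[LHS]mul1r -(bn_halfE NB) -[RHS]mulr1 -e.
by ncring.
Qed.

Lemma bn_lim_uniq u l l' : bn_lim u l -> bn_lim u l' -> l = l'.
Proof.
move=> ul ul'; apply/eqP; rewrite -subr_eq0; apply/eqP/(bn_eq0 NB).
apply/eqP; rewrite eq_le bn_ge0 andbT; apply/ler_addgt0Pr => e e0.
have e2 : 0 < e / 2 by lra.
have [n hn] := ul _ e2; have [m hm] := ul' _ e2.
have := bn_dist l (u (n + m)%N) l'; have := hn _ (leq_addr m n).
have := hm _ (leq_addl n m); rewrite [N (l - u _)]bn_distC.
lra.
Qed.

Lemma bn_lim_const l : bn_lim (fun=> l) l.
Proof. by move=> e e0; exists 0%N => p _; rewrite subrr bn_0. Qed.

Lemma bn_limD u v l m : bn_lim u l -> bn_lim v m ->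
  bn_lim (fun n => u n + v n) (l + m).
Proof.
move=> ul vm e e0; have e2 : 0 < e / 2 by lra.
have [n hn] := ul _ e2; have [k hk] := vm _ e2.
exists (n + k)%N => p hp.
have := hn _ (leq_trans (leq_addr k n) hp).
have := hk _ (leq_trans (leq_addl n k) hp).
have := bn_D NB (u p - l) (v p - m).
have -> : u p - l + (v p - m) = u p + v p - (l + m) by ncring.
lra.
Qed.

Lemma bn_limM u v l m : bn_lim u l -> bn_lim v m ->
  bn_lim (fun n => u n * v n) (l * m).
Proof.
move=> ul vm e e0.
have l0 := bn_ge0 l; have m0 := bn_ge0 m.
pose K := N l + N m + 1; have K0 : 0 < K by rewrite /K; lra.
pose d := Num.min 1 (e / (2 * K)).
have d0 : 0 < d by rewrite lt_min ltr01/= divr_gt0// mulr_gt0.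
have [n hn] := ul _ d0; have [k hk] := vm _ d0.
exists (n + k)%N => p hp.
have hu := hn _ (leq_trans (leq_addr k n) hp).
have hv := hk _ (leq_trans (leq_addl n k) hp).
have -> : u p * v p - l * m = (u p - l) * (v p - m) + (l * (v p - m) + (u p - l) * m).
  by ncring.
have h1 := bn_M NB (u p - l) (v p - m); have h2 := bn_M NB l (v p - m).
have h3 := bn_M NB (u p - l) m.
have a0 := bn_ge0 (u p - l); have b0 := bn_ge0 (v p - m).
have d1 : d <= 1 by rewrite ge_min lexx.
have dK : d * K <= e / 2.
  have : d <= e / (2 * K) by rewrite ge_min lexx orbT.
  rewrite ler_pdivlMr ?mulr_gt0//; lra.
apply: le_lt_trans (bn_D NB _ _) _.
apply: le_lt_trans (lerD h1 (le_trans (bn_D NB _ _) (lerD h2 h3))) _.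
have : N (u p - l) * N (v p - m) <= d * 1 by apply: ler_pM => //; lra.
have : N l * N (v p - m) <= N l * d by apply: ler_wpM2l => //; lra.
have : N (u p - l) * N m <= d * N m by apply: ler_wpM2r => //; lra.
move: dK; rewrite /K; nra.
Qed.

Lemma bn_lim_star u l : bn_lim u l -> bn_lim (fun n => s (u n)) (s l).
Proof.
move=> ul e /ul[n hn]; exists n => p /hn.
by rewrite -bn_starN -(bn_starD NB) (bn_star NB).
Qed.

Lemma bn_lim_shift u l : bn_lim u l -> bn_lim (fun n => u n.+1) l.
Proof. by move=> ul e /ul[n hn]; exists n => p np; apply: hn; exact: leqW. Qed.

Lemma bn_lim_le u l c : bn_lim u l -> (forall n, N (u n) <= c) -> N l <= c.
Proof.
move=> ul uc; apply/ler_addgt0Pr => e /ul[n hn].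
have := hn _ (leqnn n); have := uc n; have := bn_B (u n) (u n - l).
have -> : u n - (u n - l) = l by ncring.
lra.
Qed.

(** Increments dominated by those of a bounded real sequence make a sequence
    Cauchy. *)
Lemma bn_majorant (u : nat -> B) (t : nat -> R) M :
  (forall n, N (u n.+1 - u n) <= t n.+1 - t n) -> N (u 0%N) <= t 0%N ->
  (forall n, t n <= M) ->
  exists l, bn_lim u l /\ N l <= M.
Proof.
move=> ut u0 tM.
have mono p q : (p <= q)%N -> N (u q - u p) <= t q - t p.
  elim: q => [|q IH]; first by rewrite leqn0 => /eqP ->; rewrite !subrr bn_0.
  rewrite leq_eqVlt => /predU1P[->|/IH {}IH]; first by rewrite !subrr bn_0.
  have := bn_dist (u q.+1) (u q) (u p); have := ut q; lra.
have St : has_sup (range t).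
  by split; [exists (t 0%N), 0%N | exists M => _ [n _ <-]].
have [l ul] : exists l, bn_lim u l.
  apply: (bn_complete NB) => e e0.
  have [_ [n _ <-] hn] := sup_adherent e0 St; exists n => p q np nq.
  have le_sup k : t k <= sup (range t) by apply: ub_le_sup; [exact: St.2|exists k].
  have := le_sup p; have := le_sup q.
  have := mono _ _ np; have := mono _ _ nq.
  have := bn_ge0 (u p - u n); have := bn_ge0 (u q - u n).
  have [pq|/ltnW qp] := leqP p q.
    rewrite (bn_distC (u p) (u q)); have := mono _ _ pq; lra.
  have := mono _ _ qp; lra.
exists l; split=> //; apply: bn_lim_le ul _ => n.
have := mono 0%N n (leq0n n); have := bn_D NB (u n - u 0%N) (u 0%N).
rewrite subrK; have := tM n; lra.
Qed.

Lemma bn_lim_comm u l z : bn_lim u l -> (forall n, z * u n = u n * z) ->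
  z * l = l * z.
Proof.
move=> ul zu.
have h1 := bn_limM (bn_lim_const z) ul; have h2 := bn_limM ul (bn_lim_const z).
by apply: bn_lim_uniq h1 _; rewrite (funext zu).
Qed.

(** The equation says [(1 - y)^2 = 1 - w]. The iteration [y := (w + y^2) / 2] is
    a sequence of polynomials in [w] with nonnegative coefficients, hence
    majorized by the same iteration on real numbers started from [c]; it
    converges even for [c = 1], where it is no contraction. *)
Lemma bn_sqrt w c : N w <= c -> c <= 1 -> exists y,
  [/\ y + y = w + y * y, N y <= c,
      forall z, z * w = w * z -> z * y = y * z & s w = w -> s y = y].
Proof.
move=> wc c1; have c0 := le_trans (bn_ge0 w) wc.
pose u := fix u n := if n is n'.+1 then h * (w + u n' * u n') else 0.
pose t := fix t n := if n is n'.+1 then (c + t n' * t n') / 2 else 0 : R.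
have t01 n : 0 <= t n <= c.
  elim: n => [|n /= /andP[t0 tc]]; first by rewrite lexx.
  have : t n * t n <= c * c by apply: ler_pM.
  have : c * c <= c * 1 by apply: ler_wpM2l.
  have : 0 <= t n * t n by apply: mulr_ge0.
  by move=> *; apply/andP; split; lra.
have ut n : N (u n) <= t n.
  elim: n => [|n IH] /=; first by rewrite bn_0.
  rewrite bn_half; have := bn_D NB w (u n * u n); have := bn_M NB (u n) (u n).
  have := ler_pM (bn_ge0 _) (bn_ge0 _) IH IH; lra.
have uw n z : z * w = w * z -> z * u n = u n * z.
  move=> zw; elim: n => [|n IH] /=; first by rewrite mul0r mulr0.
  rewrite mulrA -bn_halfC -!mulrA; congr (h * _).
  by rewrite mulrDl mulrDr zw mulrA IH -mulrA IH mulrA.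
have uu n m : u m * u n = u n * u m := uw n _ (esym (uw m _ erefl)).
have du n : N (u n.+1 - u n) <= t n.+1 - t n.
  elim: n => [|n IH]; first by rewrite /= mulr0 !addr0 !subr0 mul0r addr0 bn_half; lra.
  have -> : u n.+2 - u n.+1 = h * ((u n.+1 + u n) * (u n.+1 - u n)).
    have e1 : u n.+1 = h * (w + u n * u n) by [].
    have -> : u n.+2 = h * (w + u n.+1 * u n.+1) by [].
    have := uu n n.+1; move: (u n.+1) (u n) e1 => a b e1 ab.
    have -> : (a + b) * (a - b) = (w + a * a) - (w + b * b) + (b * a - a * b).
      by ncring.
    by rewrite ab subrr addr0 mulrBr -e1.
  rewrite bn_half.
  have tE : t n.+1 = (c + t n * t n) / 2 by [].
  have -> : t n.+2 = (c + t n.+1 * t n.+1) / 2 by [].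
  have h1 := bn_M NB (u n.+1 + u n) (u n.+1 - u n).
  have h2 := le_trans (bn_D NB (u n.+1) (u n)) (lerD (ut n.+1) (ut n)).
  have := le_trans h1 (ler_pM (bn_ge0 _) (bn_ge0 _) h2 IH).
  move: (N _) (t n.+1) (t n) tE => m a b ->; nra.
(* The limit inherits every closed property of the iterates. *)
have [y [uy yc]] := bn_majorant du (ut 0%N) (fun n => (andP (t01 n)).2).
have yE : y = h * (w + y * y).
  apply: bn_lim_uniq (bn_lim_shift uy) _.
  exact: bn_limM (bn_lim_const h) (bn_limD (bn_lim_const w) (bn_limM uy uy)).
exists y; split=> //.
- by rewrite {1 2}yE -mulrDl (bn_halfE NB) mul1r.
- by move=> z zw; apply: bn_lim_comm uy _ => n; exact: uw.
move=> sw; apply: bn_lim_uniq (bn_lim_star uy) _.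
have -> : (fun n => s (u n)) = u; last by [].
apply: funext; elim=> [|n IH] /=.
  exact: bn_star0.
by rewrite (bn_starM NB) bn_star_half (bn_starD NB) sw (bn_starM NB) IH bn_halfC.
Qed.

Lemma bn_neumann w : N w < 1 -> exists z,
  [/\ (1 - w) * z = 1, z * (1 - w) = 1 & N z <= N 1 / (1 - N w)].
Proof.
move=> w1; set c := N w in w1 *; have c0 : 0 <= c := bn_ge0 w.
have n1 : 0 <= N 1 := bn_ge0 1.
pose u n := \sum_(k < n) w ^+ k.
pose t n := N 1 * \sum_(k < n) c ^+ k.
have du n : N (u n.+1 - u n) <= t n.+1 - t n.
  rewrite /u /t !big_ord_recr/= mulrDr [X in N X]addrAC subrr add0r.
  rewrite [X in _ <= X]addrAC subrr add0r.
  elim: n => [|n IH]; first by rewrite !expr0 mulr1.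
  rewrite exprSr (le_trans (bn_M NB _ _))// exprSr mulrA.
  by rewrite ler_wpM2r.
have u0 : N (u 0%N) <= t 0%N by rewrite /u /t !big_ord0 bn_0 mulr0.
have tM n : t n <= N 1 / (1 - c).
  rewrite /t ler_wpM2l// -[(1 - c)^-1]mul1r ler_pdivlMr; last by lra.
  by have := subrX1 c n; have := exprn_ge0 n c0; lra.
have [z [uz zM]] := bn_majorant du u0 tM.
have uE n : u n.+1 = 1 + w * u n.
  rewrite /u big_ord_recl expr0 big_distrr/=; congr (_ + _).
  by apply: eq_bigr => i _; rewrite -exprS.
have zE : z = 1 + w * z.
  apply: bn_lim_uniq (bn_lim_shift uz) _; rewrite (funext uE).
  exact: bn_limD (bn_lim_const 1) (bn_limM (bn_lim_const w) uz).
have wz : w * z = z * w.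
  apply: bn_lim_comm uz _ => n; elim: n => [|n IH].
    by rewrite /u big_ord0 mul0r mulr0.
  by rewrite uE mulrDr mulrDl mulr1 mul1r -[w * u n * w]mulrA -IH.
have z1 : (1 - w) * z = 1 by rewrite mulrBl mul1r {1}zE addrK.
by exists z; split=> //; rewrite -[RHS]z1 mulrBl mulrBr mul1r mulr1 wz.
Qed.

Lemma inverse_comm a b x : a * b = 1 -> b * a = 1 -> x * a = a * x ->
  x * b = b * x :> B.
Proof.
by move=> ab ba xa; rewrite -[x * b]mul1r -ba -mulrA [a * _]mulrA -xa -!mulrA ab mulr1.
Qed.

Lemma inverse_star a b : a * b = 1 -> b * a = 1 -> s a = a -> s b = b.
Proof.
move=> ab ba sa; rewrite -[s b]mulr1 -ab mulrA -{1}sa -(bn_starM NB).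
by rewrite ab bn_star1 mul1r.
Qed.

(** [1 + w z] is the inverse square root of [1 - w]. The factor [w] is split off
    because it carries the result into any ideal that contains [w]. *)
Lemma bn_inverse_sqrt w : N w <= 1 / 4 -> exists z,
  [/\ (1 - w) * ((1 + w * z) * (1 + w * z)) = 1, N z <= N 1 ^+ 2,
      forall x, x * w = w * x -> x * z = z * x & s w = w -> s z = z].
Proof.
move=> w4; have [|y [yE yc yC ys]] := bn_sqrt w4; first lra.
have hy : N (h * y) < 1 by rewrite bn_half; lra.
have [k [k1 k2 kN]] := bn_neumann hy.
have y1 : N y < 1 by lra.
have [g [g1 g2 gN]] := bn_neumann y1.
have kC x : x * w = w * x -> x * k = k * x.
  move=> /yC xy; apply: inverse_comm k1 k2 _.
  by rewrite mulrBr mulrBl mulr1 mul1r mulrA -bn_halfC -!mulrA xy.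
have gC x : x * w = w * x -> x * g = g * x.
  by move=> /yC xy; apply: inverse_comm g1 g2 _; rewrite mulrBr mulrBl mulr1 mul1r xy.
(* [2 y - y^2 = w] exhibits [y] as a multiple of [w]. *)
have yk : y = w * (h * k).
  have e : y * (1 - h * y) = h * w.
    have -> : w = y + y - y * y by rewrite yE addrK.
    have -> : h * (y + y - y * y) = (h + h) * y - h * y * y by ncring.
    by rewrite (bn_halfE NB) mul1r mulrBr mulr1 mulrA -bn_halfC.
  have : y * (1 - h * y) * k = h * w * k by rewrite e.
  by rewrite -mulrA k1 mulr1 bn_halfC -mulrA.
have gE : g = 1 + w * (h * k * g).
  by rewrite !mulrA -[w * h * k]mulrA -yk -g1; ncring.
exists (h * k * g); rewrite -gE; split.
- have -> : 1 - w = (1 - y) * (1 - y).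
    have -> : w = y + y - y * y by rewrite yE addrK.
  by ncring.
  by rewrite -mulrA [(1 - y) * (g * g)]mulrA g1 mul1r.
- have := bn_M NB (h * k) g; rewrite bn_half.
  have k0 := bn_ge0 k; have g0 := bn_ge0 g; have n0 := bn_ge0 1.
  have ky : N 1 / (1 - N (h * y)) <= 8 / 7 * N 1.
    rewrite ler_pdivrMr; last by lra.
    rewrite bn_half; nra.
  have gy : N 1 / (1 - N y) <= 4 / 3 * N 1.
    rewrite ler_pdivrMr; last by lra.
    nra.
  have {}ky := le_trans kN ky; have {}gy := le_trans gN gy.
  move/le_trans; apply.
  have : N k * N g <= (8 / 7 * N 1) * (4 / 3 * N 1) by apply: ler_pM.
  by rewrite expr2; nra.
- by move=> x xw; rewrite !mulrA -bn_halfC -[h * x * k]mulrA kC// -!mulrA gC.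
- move=> sw.
  have sk : s k = k.
    apply: inverse_star k1 k2 _.
    by rewrite (bn_starD NB) bn_star1 bn_starN (bn_starM NB) bn_star_half ys// bn_halfC.
  have sg : s g = g.
    by apply: inverse_star g1 g2 _; rewrite (bn_starD NB) bn_star1 bn_starN ys.
  have gk : g * k = k * g by apply: kC; exact/esym/gC.
  by rewrite !(bn_starM NB) sk sg bn_star_half -bn_halfC mulrA -bn_halfC -mulrA gk mulrA.
Qed.

End BanachStarRing.

(** * The C*-norm of the unitization *)

Lemma cauchy_sequence_limit (K : numFieldType) (V : completeNormedModType K)
    (u : nat -> V) :
  (forall e : K, 0 < e -> exists n, forall p q, (n <= p)%N -> (n <= q)%N ->
     `|u p - u q| < e) ->
  exists l, forall e : K, 0 < e -> exists n, forall p, (n <= p)%N ->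
     `|u p - l| < e.
Proof.
move=> uC.
have /cauchy_cvg/cvg_ex[l ul] : cauchy (u @ \oo).
  apply/cauchy_ballP => e e0; have [n hn] := uC _ e0.
  exists ([set x | exists2 p, (n <= p)%N & x = u p],
          [set x | exists2 p, (n <= p)%N & x = u p]) => /=.
    by split; exists n => // p /= np; exists p.
  by case=> _ _ [[p np ->] [q nq ->]]; rewrite -ball_normE /=; exact: hn.
exists l => e e0; move/cvgrPdist_lt/(_ e e0): ul => [n _ hn].
by exists n => p np; rewrite distrC; exact: hn.
Qed.

Section RealNorm.
Context {R : realType}.

(** The norm of a module over [R[i]] is a complex number; [nm] is its value as a
    real number. *)
Definition nm (V : normedZmodType R[i]) (x : V) : R := complex.Re `|x|.

Section Basics.
Context {V : normedZmodType R[i]}.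
Implicit Types x y : V.

Lemma nmE x : `|x| = (nm x)%:C.
Proof. by rewrite /nm RRe_real// normr_real. Qed.

Lemma nm_ge0 x : 0 <= nm x.
Proof. by rewrite -ler0c -nmE. Qed.

Lemma nm_D x y : nm (x + y) <= nm x + nm y.
Proof. by rewrite -lecR rmorphD /= -!nmE ler_normD. Qed.

Lemma nm_N x : nm (- x) = nm x.
Proof. by rewrite /nm normrN. Qed.

Lemma nm_B x y : nm (x - y) <= nm x + nm y.
Proof. by rewrite -(nm_N y); exact: nm_D. Qed.

Lemma nm_0 : nm (0 : V) = 0.
Proof. by rewrite /nm normr0. Qed.

Lemma nm_eq0 x : nm x = 0 -> x = 0.
Proof. by move=> x0; apply/eqP; rewrite -normr_eq0 nmE x0. Qed.

End Basics.

Lemma nm_Z (V : normedModType R[i]) (c : R[i]) (x : V) :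
  nm (c *: x) = nm c * nm x.
Proof. by apply: complexI; rewrite rmorphM /= -!nmE normrZ. Qed.

Lemma nm_cM (c d : R[i]) : nm (c * d) = nm c * nm d.
Proof. by apply: complexI; rewrite rmorphM /= -!nmE normrM. Qed.

Lemma nm_conj (c : R[i]) : nm (conjc c) = nm c.
Proof. by apply: complexI; rewrite -!nmE normcJ. Qed.

Lemma nm_real (t : R) : nm t%:C = `|t|.
Proof. by rewrite /nm normc_def /= expr0n addr0 sqrtr_sqr. Qed.

Lemma nm_1 : nm (1 : R[i]) = 1.
Proof. by rewrite /nm normr1. Qed.

Lemma nm_Re (c : R[i]) : `|complex.Re c| <= nm c.
Proof. by rewrite -lecR -nmE; exact: normc_ge_Re. Qed.

Lemma nm_Im (c : R[i]) : `|complex.Im c| <= nm c.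
Proof.
have <- : nm (c * 'i) = nm c.
  by rewrite nm_cM /nm normc_def /= expr0n expr1n add0r sqrtr1 mulr1.
by rewrite -normrN -ReiNIm; exact: nm_Re.
Qed.

Lemma nm_complete (V : completeNormedModType R[i]) (u : nat -> V) :
  (forall e, 0 < e -> exists n, forall p q, (n <= p)%N -> (n <= q)%N ->
     nm (u p - u q) < e) ->
  exists l, forall e, 0 < e -> exists n, forall p, (n <= p)%N ->
     nm (u p - l) < e.
Proof.
move=> uC; have [e e0|l ul] := @cauchy_sequence_limit _ _ u.
  have eE : e = (complex.Re e)%:C by rewrite RRe_real// gtr0_real.
  have [|n hn] := uC (complex.Re e); first by rewrite -ltcR -eE.
  by exists n => p q np nq; rewrite nmE eE ltcR; exact: hn.
exists l => e e0; have [|n hn] := ul e%:C; first by rewrite ltcR.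
by exists n => p np; rewrite -ltcR -nmE; exact: hn.
Qed.

Lemma nm_complex_complete (u : nat -> R[i]) :
  (forall e, 0 < e -> exists n, forall p q, (n <= p)%N -> (n <= q)%N ->
     nm (u p - u q) < e) ->
  exists l, forall e, 0 < e -> exists n, forall p, (n <= p)%N ->
     nm (u p - l) < e.
Proof.
move=> uC.
have [|a ha] := @cauchy_sequence_limit R R (fun n => complex.Re (u n)).
  move=> e /uC[n hn]; exists n => p q np nq.
  have -> : complex.Re (u p) - complex.Re (u q) = complex.Re (u p - u q).
    by case: (u p) (u q) => ? ? [].
  exact: le_lt_trans (nm_Re _) (hn _ _ np nq).
have [|b hb] := @cauchy_sequence_limit R R (fun n => complex.Im (u n)).
  move=> e /uC[n hn]; exists n => p q np nq.
  have -> : complex.Im (u p) - complex.Im (u q) = complex.Im (u p - u q).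
    by case: (u p) (u q) => ? ? [].
  exact: le_lt_trans (nm_Im _) (hn _ _ np nq).
exists (a +i* b) => e e0; have e2 : 0 < e / 2 by lra.
have [n hn] := ha _ e2; have [m hm] := hb _ e2; exists (n + m)%N => p hp.
have -> : u p - (a +i* b) =
    (complex.Re (u p) - a)%:C + (complex.Im (u p) - b)%:C * 'i.
  by case: (u p) => x y; apply/eqP; rewrite eq_complex /=; apply/andP; split; apply/eqP; ring.
have i1 : nm ('i : R[i]) = 1 by rewrite /nm normc_def /= expr0n expr1n add0r sqrtr1.
apply: le_lt_trans (nm_D _ _) _; rewrite nm_cM i1 mulr1 !nm_real.
have := hn _ (leq_trans (leq_addr _ _) hp).
have := hm _ (leq_trans (leq_addl _ _) hp).
lra.
Qed.

End RealNorm.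

Section UnitizationNorm.
Context {R : realType} {A : cstarAlgType R}.
Local Notation Ad := (unitization A).
Implicit Types (X Y : Ad) (a b : A) (c d : R).

Lemma nm_cmul a b : nm (cmul a b) <= nm a * nm b.
Proof. by rewrite -lecR rmorphM /= -!nmE; exact: normr_cmul. Qed.

Lemma nm_cstar a : nm (cmul (star a) a) = nm a ^+ 2.
Proof. by apply: complexI; rewrite rmorphXn /= -!nmE; exact: normr_cstar. Qed.

Lemma nm_star a : nm (star a) = nm a.
Proof.
suff h b : nm b <= nm (star b) by apply/eqP; rewrite eq_le h -{2}(starK a) h.
have [->|b0] := eqVneq b 0; first by rewrite star0.
have : 0 < nm b by rewrite lt0r nm_ge0 andbT; apply: contra b0 => /eqP/nm_eq0 ->.
by move=> n0; rewrite -(ler_pM2r n0) -expr2 -nm_cstar; exact: nm_cmul.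
Qed.

(** The left regular representation of the unitization on [A]. *)
Definition acts X b : A := cmul X.1 b + X.2 *: b.

Lemma actsM X Y b : acts (X * Y) b = acts X (acts Y b).
Proof.
rewrite /acts /= !cmulDl !cmulDr !cmulZl cmulZr scalerDr cmulA scalerA -!addrA.
by congr (_ + _); rewrite addrCA.
Qed.

Lemma actsD X Y b : acts (X + Y) b = acts X b + acts Y b.
Proof. by rewrite /acts /= cmulDl scalerDl addrACA. Qed.

Lemma star_acts X a b : cmul (star (acts X a)) b = cmul (star a) (acts (star X) b).
Proof. by rewrite /acts starD star_cmul starZ cmulDl cmulDr cmulZl cmulZr cmulA. Qed.

Definition bounded_by X c : Prop :=
  nm X.2 <= c /\ forall b, nm (acts X b) <= c * nm b.

Lemma bounded_by_sum X : bounded_by X (nm X.1 + nm X.2).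
Proof.
split=> [|b]; first by rewrite lerDr nm_ge0.
rewrite mulrDl; apply: le_trans (nm_D _ _) _.
by rewrite nm_Z lerD2r nm_cmul.
Qed.

(** The larger of the operator norm of [acts X] and of the modulus of the scalar
    part. The second term makes this a norm also when [A] is unital, where
    [acts] has a kernel. *)
Definition unorm X : R := inf [set c | bounded_by X c].

Lemma unormP X c : unorm X <= c <-> bounded_by X c.
Proof.
have lb : has_inf [set c | bounded_by X c].
  split; first by exists (nm X.1 + nm X.2); exact: bounded_by_sum.
  by exists 0 => d [/(le_trans (nm_ge0 _))].
have up d : unorm X < d -> bounded_by X d.
  move=> /(inf_lt lb.1)[e [e1 e2] ed]; split.
    exact: le_trans e1 (ltW ed).
  by move=> b; apply: le_trans (e2 b) _; rewrite ler_wpM2r// ?nm_ge0// ltW.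
split=> [Xc|Xc]; last by apply: ge_inf => //; exact: lb.2.
split=> [|b].
  apply/ler_addgt0Pr => e e0; apply: (up (c + e) _).1; lra.
apply/ler_addgt0Pr => e e0.
have b0 := nm_ge0 b; pose d := e / (nm b + 1).
have d0 : 0 < d by rewrite divr_gt0//; lra.
have de : d * (nm b + 1) = e by rewrite /d divfK//; lra.
have := (up (c + d) _).2 b; have : unorm X < c + d by lra.
move=> h /(_ h); nra.
Qed.

Lemma unorm_bounded X : bounded_by X (unorm X).
Proof. exact/unormP. Qed.

Lemma unorm_ge0 X : 0 <= unorm X.
Proof. exact: le_trans (nm_ge0 _) (unorm_bounded X).1. Qed.

Lemma unorm_scalar_le X : nm X.2 <= unorm X.
Proof. exact: (unorm_bounded X).1. Qed.

Lemma unorm_le X : unorm X <= nm X.1 + nm X.2.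
Proof. by apply/unormP; exact: bounded_by_sum. Qed.

Lemma unorm_alg_le X : nm X.1 <= 2 * unorm X.
Proof.
have [X2 XA] := unorm_bounded X.
have [->|X0] := eqVneq X.1 0; first by rewrite nm_0 mulr_ge0// unorm_ge0.
have n0 : 0 < nm X.1.
  by rewrite lt0r nm_ge0 andbT; apply: contra X0 => /eqP/nm_eq0 ->.
rewrite -(ler_pM2r n0) -expr2 -[X in _ * X]nm_star -[nm X.1]nm_star -nm_cstar starK.
have -> : cmul X.1 (star X.1) = acts X (star X.1) - X.2 *: star X.1 by rewrite addrK.
apply: le_trans (nm_B _ _) _; rewrite nm_Z; have := XA (star X.1).
have : nm X.2 * nm (star X.1) <= unorm X * nm (star X.1).
  by rewrite ler_wpM2r// nm_ge0.
lra.
Qed.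

Lemma unorm_star X : unorm (star X) = unorm X.
Proof.
suff h Y : unorm (star Y) <= unorm Y.
  by apply/eqP; rewrite eq_le h -{1}(starK X) h.
have [Y2 YA] := unorm_bounded Y; apply/unormP; split=> [|b] /=.
  by rewrite nm_conj.
have [->|n0] := eqVneq (nm (acts (star Y) b)) 0.
  by rewrite mulr_ge0// ?nm_ge0// unorm_ge0.
have {}n0 : 0 < nm (acts (star Y) b) by rewrite lt0r n0 nm_ge0.
rewrite -(ler_pM2r n0) -expr2 -nm_cstar star_acts starK.
apply: le_trans (nm_cmul _ _) _; rewrite nm_star -mulrA mulrCA.
by rewrite ler_wpM2l// nm_ge0.
Qed.

(** The C*-identity of [A], applied to [X b], is inherited by the operator
    norm. *)
Lemma unorm_cstar_le X c : 0 <= c -> unorm (star X * X) <= c ^+ 2 -> unorm X <= c.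
Proof.
move=> c0 /unormP[/= X2 XA]; apply/unormP; split=> [|b].
  rewrite -(ler_pXn2r (_ : (0 < 2)%N))// ?nnegrE ?nm_ge0//.
  by move: X2; rewrite nm_cM nm_conj -expr2.
rewrite -(ler_pXn2r (_ : (0 < 2)%N))// ?nnegrE ?mulr_ge0 ?nm_ge0//.
rewrite -nm_cstar star_acts -actsM exprMn.
apply: le_trans (nm_cmul _ _) _; rewrite nm_star mulrC [nm b ^+ 2]expr2 mulrA.
by rewrite ler_wpM2r// nm_ge0.
Qed.

Lemma unorm_D X Y : unorm (X + Y) <= unorm X + unorm Y.
Proof.
have [X2 XA] := unorm_bounded X; have [Y2 YA] := unorm_bounded Y.
apply/unormP; split=> [|b] /=; first exact: le_trans (nm_D _ _) (lerD X2 Y2).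
by rewrite actsD mulrDl; exact: le_trans (nm_D _ _) (lerD (XA b) (YA b)).
Qed.

Lemma unorm_M X Y : unorm (X * Y) <= unorm X * unorm Y.
Proof.
have [X2 XA] := unorm_bounded X; have [Y2 YA] := unorm_bounded Y.
apply/unormP; split=> [|b] /=; first by rewrite nm_cM ler_pM// nm_ge0.
rewrite actsM (le_trans (XA _))// -mulrA ler_wpM2l// unorm_ge0//.
Qed.

Definition sc (z : R[i]) : Ad := (0, z).

Lemma scD z w : sc (z + w) = sc z + sc w.
Proof. by rewrite /sc; congr pair; rewrite addr0. Qed.

Lemma scN z : sc (- z) = - sc z.
Proof. by rewrite /sc; congr pair; rewrite oppr0. Qed.

Lemma scM z w : sc (z * w) = sc z * sc w.
Proof. by rewrite /sc; congr pair; rewrite cmul0l !scaler0 !addr0. Qed.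

Lemma scC z X : sc z * X = X * sc z.
Proof.
by congr pair => /=; [rewrite cmul0l cmul0r !scaler0 !addr0 !add0r|rewrite mulrC].
Qed.

Lemma sc_star z : star (sc z) = sc (conjc z).
Proof. by congr pair; rewrite /= star0. Qed.

Lemma sc1 : sc 1 = 1. Proof. by []. Qed.

Lemma unorm_sc z : unorm (sc z) <= nm z.
Proof. by apply: le_trans (unorm_le _) _; rewrite nm_0 add0r. Qed.

Lemma unorm_scM z X : unorm (sc z * X) <= nm z * unorm X.
Proof. by rewrite (le_trans (unorm_M _ _))// ler_wpM2r ?unorm_ge0 ?unorm_sc. Qed.

Lemma unorm_1 : unorm 1 <= 1.
Proof. by rewrite -sc1 -[X in _ <= X](@nm_1 R) unorm_sc. Qed.

Lemma unorm_N X : unorm (- X) = unorm X.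
Proof.
suff h Y : unorm (- Y) <= unorm Y by apply/eqP; rewrite eq_le h -{1}(opprK X) h.
have -> : - Y = sc (- 1) * Y by rewrite scN sc1 mulN1r.
by apply: le_trans (unorm_scM _ _) _; rewrite nm_N nm_1 mul1r.
Qed.

Lemma unorm_real t X : 0 <= t -> unorm (sc t%:C * X) <= t * unorm X.
Proof. by move=> t0; apply: le_trans (unorm_scM _ _) _; rewrite nm_real ger0_norm. Qed.

Lemma unorm_eq0 X : unorm X = 0 -> X = 0.
Proof.
move=> X0; have := unorm_scalar_le X; have := unorm_alg_le X; rewrite X0 mulr0.
case: X {X0} => a z /= a0 z0; congr pair; apply: nm_eq0; apply/eqP.
  by rewrite eq_le a0 nm_ge0.
by rewrite eq_le z0 nm_ge0.
Qed.

Definition uhalf : Ad := sc (2^-1)%:C.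

Lemma uhalfE : uhalf + uhalf = 1.
Proof.
rewrite /uhalf -scD -sc1 -rmorphD /=; congr (sc _%:C).
by rewrite [LHS](_ : _ = 1) //; lra.
Qed.

Lemma unorm_double X : unorm (X + X) = unorm X + unorm X.
Proof.
apply/eqP; rewrite eq_le unorm_D /=.
have XE : X = uhalf * (X + X) by rewrite mulrDr -mulrDl uhalfE mul1r.
have h0 : 0 <= 2^-1 :> R by rewrite invr_ge0.
have := unorm_real (X + X) h0; rewrite -/uhalf -XE; lra.
Qed.

Lemma unorm_complete (u : nat -> Ad) :
  (forall e, 0 < e -> exists n, forall p q, (n <= p)%N -> (n <= q)%N ->
     unorm (u p - u q) < e) ->
  exists l, forall e, 0 < e -> exists n, forall p, (n <= p)%N ->
     unorm (u p - l) < e.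
Proof.
move=> uC.
have [e e0|a ha] := nm_complete (u := fun n => (u n).1).
  have [|n hn] := uC (e / 2); first lra.
  exists n => p q np nq; have := hn _ _ np nq; have := unorm_alg_le (u p - u q).
  by move=> /=; lra.
have [e e0|z hz] := nm_complex_complete (u := fun n => (u n).2).
  have [n hn] := uC _ e0; exists n => p q np nq.
  exact: le_lt_trans (unorm_scalar_le (u p - u q)) (hn _ _ np nq).
exists (a, z) => e e0; have e2 : 0 < e / 2 by lra.
have [n hn] := ha _ e2; have [m hm] := hz _ e2; exists (n + m)%N => p hp.
apply: le_lt_trans (unorm_le _) _ => /=.
have := hn _ (leq_trans (leq_addr _ _) hp).
have := hm _ (leq_trans (leq_addl _ _) hp).
lra.
Qed.

Lemma unorm_banach_star : banach_star unorm (star : Ad -> Ad) uhalf.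
Proof.
split; [exact: unorm_D|exact: unorm_N|exact: unorm_M|exact: unorm_double|
  exact: unorm_eq0|exact: unorm_complete|exact: uhalfE|exact: starD|
  exact: starM|exact: starK|exact: unorm_star].
Qed.

End UnitizationNorm.

(** * Positive elements and Kaplansky's theorem *)

Section Positivity.
Context {R : realType} {A : cstarAlgType R}.
Local Notation Ad := (unitization A).
Implicit Types (X Y Z : Ad) (c d t : R).

Let NB := @unorm_banach_star R A.

Lemma conjc_i : conjc 'i = - 'i :> R[i].
Proof. by apply/eqP; rewrite eq_complex /= oppr0 !eqxx. Qed.

Definition rsc t : Ad := sc t%:C.

Lemma scMM (z w : R[i]) X Y : (sc z * X) * (sc w * Y) = sc (z * w) * (X * Y).
Proof. by rewrite scM -!mulrA; congr (_ * _); rewrite !mulrA scC. Qed.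

Lemma sc_starM (z : R[i]) X : star (sc z * X) = sc (conjc z) * star X.
Proof. by rewrite starM sc_star scC. Qed.

Lemma rscMM c d X Y : (rsc c * X) * (rsc d * Y) = rsc (c * d) * (X * Y).
Proof. by rewrite /rsc rmorphM scMM. Qed.

Lemma rscM c d : rsc (c * d) = rsc c * rsc d.
Proof. by rewrite /rsc rmorphM scM. Qed.

Lemma rscD c d : rsc (c + d) = rsc c + rsc d.
Proof. by rewrite /rsc rmorphD scD. Qed.

Lemma rscC c X : rsc c * X = X * rsc c. Proof. exact: scC. Qed.

Lemma rsc1 : rsc 1 = 1. Proof. by []. Qed.

Lemma rscVK c X : c != 0 -> rsc c * (rsc c^-1 * X) = X.
Proof. by move=> c0; rewrite mulrA -rscM divff// rsc1 mul1r. Qed.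

Lemma rsc_star c : star (rsc c) = rsc c.
Proof. by rewrite /rsc sc_star conjc_real. Qed.

Lemma rsc_starM c X : star (rsc c * X) = rsc c * star X.
Proof. by rewrite starM rsc_star rscC. Qed.

Lemma starN X : star (- X) = - star X. Proof. exact: (bn_starN NB). Qed.

Lemma starB X Y : star (X - Y) = star X - star Y.
Proof. by rewrite starD starN. Qed.

Lemma unorm_rsc c : 0 <= c -> unorm (rsc c) <= c.
Proof. by move=> c0; apply: le_trans (unorm_sc _) _; rewrite nm_real ger0_norm. Qed.

Lemma unorm_rscM c X : 0 <= c -> unorm (rsc c * X) <= c * unorm X.
Proof. exact: unorm_real. Qed.

Lemma unorm_rscX c m : 0 <= c -> unorm (rsc c ^+ m) <= c ^+ m.
Proof.
move=> c0; elim: m => [|m IH]; first by rewrite !expr0 unorm_1.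
rewrite !exprS; apply: le_trans (unorm_rscM _ c0) _.
by rewrite ler_wpM2l.
Qed.

Lemma cstar_eq0 X : star X * X = 0 -> X = 0.
Proof.
move=> X0; apply: unorm_eq0; apply/eqP; rewrite eq_le unorm_ge0 andbT.
by apply: unorm_cstar_le => //; rewrite X0 expr0n (bn_0 NB).
Qed.

Lemma sa_sqr_eq0 X : star X = X -> X * X = 0 -> X = 0.
Proof. by move=> Xs X0; apply: cstar_eq0; rewrite Xs. Qed.

(** For self-adjoint [X] the norm condition says that the spectrum of [X] lies in
    [[0, 2t]]. In this form positivity is visibly stable under addition. *)
Definition upos X : Prop :=
  star X = X /\ exists t, unorm (rsc t - X) <= t.

Lemma upos_large X : upos X -> exists t, forall t', t <= t' ->
  unorm (rsc t' - X) <= t'.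
Proof.
move=> [_ [t tX]]; exists t => t' tt'.
have -> : rsc t' - X = rsc (t' - t) + (rsc t - X).
  by rewrite addrA -rscD subrK.
have d0 : 0 <= t' - t by rewrite subr_ge0.
by have := unorm_rsc d0; have := unorm_D (rsc (t' - t)) (rsc t - X); lra.
Qed.

Lemma upos_add X Y : upos X -> upos Y -> upos (X + Y).
Proof.
move=> [Xs [t tX]] [Ys [r rY]]; split; first by rewrite starD Xs Ys.
exists (t + r).
have -> : rsc (t + r) - (X + Y) = (rsc t - X) + (rsc r - Y).
  by rewrite rscD; ncring.
by have := unorm_D (rsc t - X) (rsc r - Y); lra.
Qed.

(** Rescale to [1 - w] with [w] of norm at most 1 and apply [bn_sqrt]. *)
Lemma upos_sqrt X : upos X -> exists H,
  [/\ upos H, H * H = X & forall Z, Z * X = X * Z -> Z * H = H * Z].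
Proof.
move=> Xp; have Xs := Xp.1; have [t0 tX] := upos_large Xp.
pose t := Num.max t0 1; have t1 : 1 <= t by rewrite le_max lexx orbT.
have {}tX : unorm (rsc t - X) <= t by apply: tX; rewrite le_max lexx.
have tn : t != 0 by rewrite gt_eqF//; lra.
pose w := rsc t^-1 * (rsc t - X).
have wE : w = 1 - rsc t^-1 * X by rewrite /w mulrBr -rscM mulVf.
have w1 : unorm w <= 1.
  have ti : 0 <= t^-1 by rewrite invr_ge0; lra.
  apply: le_trans (unorm_rscM _ ti) _.
  by rewrite -(mulVf tn) ler_wpM2l.
have [y [yE y1 yC ys]] := bn_sqrt NB w1 (lexx 1).
have st : Num.sqrt t * Num.sqrt t = t by rewrite -expr2 sqr_sqrtr//; lra.
exists (rsc (Num.sqrt t) * (1 - y)); split.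
- split.
    rewrite rsc_starM starB (bn_star1 NB) ys//.
    by rewrite wE starB (bn_star1 NB) rsc_starM Xs.
  exists (Num.sqrt t).
  have -> : rsc (Num.sqrt t) - rsc (Num.sqrt t) * (1 - y) = rsc (Num.sqrt t) * y.
    by ncring.
  apply: le_trans (unorm_rscM _ (sqrtr_ge0 _)) _.
  by rewrite -[X in _ <= X]mulr1 ler_wpM2l// sqrtr_ge0.
- rewrite rscMM st.
  have -> : (1 - y) * (1 - y) = 1 - (y + y) + y * y by ncring.
  rewrite yE wE.
  have -> : 1 - (1 - rsc t^-1 * X + y * y) + y * y = rsc t^-1 * X by ncring.
  exact: rscVK.
- move=> Z ZX; have Zy : Z * y = y * Z.
    by apply: yC; rewrite wE mulrBl mulrBr mul1r mulr1 mulrA -rscC -!mulrA ZX.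
  by rewrite mulrA -rscC -!mulrA mulrBl mulrBr mulr1 mul1r Zy.
Qed.

(** For a self-adjoint contraction [Z] put [Y = (1 - Z^2)^(1/2)]. Then
    [Z + i Y] is unitary, so its imaginary part [Y] is a contraction, and so is
    [Y^2 = 1 - Z^2]. *)
Lemma upos_sqr Z : star Z = Z -> upos (Z * Z).
Proof.
move=> Zs; pose c := unorm Z + 1; have Z0 := unorm_ge0 Z.
have c0 : 0 < c by rewrite /c; lra.
have cn : c != 0 by rewrite gt_eqF.
pose Z' := rsc c^-1 * Z.
have Z's : star Z' = Z' by rewrite rsc_starM Zs.
have Z'1 : unorm Z' <= 1.
  have ci : 0 <= c^-1 by rewrite invr_ge0 ltW.
  apply: le_trans (unorm_rscM _ ci) _; rewrite -(mulVf cn) ler_wpM2l//.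
  by rewrite /c; lra.
have w1 : unorm (Z' * Z') <= 1.
  apply: le_trans (unorm_M _ _) _; rewrite -[X in _ <= X]mulr1.
  by rewrite ler_pM// unorm_ge0.
have [y [yE y1 yC ys]] := bn_sqrt NB w1 (lexx 1).
have {}ys : star y = y by apply: ys; rewrite starM Z's.
have Z'y : Z' * y = y * Z' by apply: yC; rewrite mulrA.
pose Y := 1 - y.
have Ys : star Y = Y by rewrite starB (bn_star1 NB) ys.
have YY : Y * Y = 1 - Z' * Z'.
  have -> : Y * Y = 1 - (y + y) + y * y by rewrite /Y; ncring.
  by rewrite yE; ncring.
have Z'Y : Z' * Y = Y * Z' by rewrite mulrBl mulrBr mulr1 mul1r Z'y.
pose i := sc 'i : Ad.
have is' : star i = - i by rewrite sc_star -scN conjc_i.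
have ii : i * i = -1 by rewrite -scM -expr2 sqr_i scN.
pose U := Z' + i * Y.
have Us : star U = Z' - i * Y.
  by rewrite starD Z's starM is' Ys mulrN -scC.
have UU : star U * U = 1.
  rewrite Us /U.
  have -> : (Z' - i * Y) * (Z' + i * Y) =
      Z' * Z' - (i * i) * (Y * Y) + i * (Z' * Y - Y * Z')
      + (Z' * i - i * Z') * Y + i * (i * Y - Y * i) * Y.
    by ncring.
  by rewrite Z'Y -(scC _ Z') -(scC _ Y) !subrr !mulr0 mul0r !addr0 ii YY; ncring.
have U1 : unorm U <= 1 by apply: unorm_cstar_le => //; rewrite UU expr1n unorm_1.
have Y1 : unorm Y <= 1.
  have -> : Y = uhalf * (- i * (U - star U)).
    rewrite Us /U.
    have -> : - i * (Z' + i * Y - (Z' - i * Y)) = - (i * i) * (Y + Y) by ncring.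
    by rewrite ii opprK mul1r mulrDr -mulrDl uhalfE mul1r.
  rewrite (bn_half NB).
  have := unorm_M (- i) (U - star U); rewrite unorm_N.
  have : unorm i <= 1.
    apply: le_trans (unorm_sc _) _.
    by rewrite /nm normc_def /= expr0n expr1n add0r sqrtr1.
  have := bn_B NB U (star U); rewrite unorm_star.
  have := unorm_ge0 i; have := unorm_ge0 (U - star U); have := unorm_ge0 U.
  nra.
split; first by rewrite starM Zs.
exists (c * c).
have -> : rsc (c * c) - Z * Z = rsc (c * c) * (Y * Y).
  by rewrite YY mulrBr mulr1 -rscMM /Z' !rscVK.
have c2 : 0 <= c * c by rewrite mulr_ge0// ltW.
apply: le_trans (unorm_rscM _ c2) _; rewrite -[X in _ <= X]mulr1 ler_wpM2l//.
apply: le_trans (unorm_M _ _) _; rewrite -[X in _ <= X]mulr1.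
by rewrite ler_pM// unorm_ge0.
Qed.

(** If [H^2 = X] and [K^2 = - X] with commuting self-adjoint [H] and [K], then
    [H + i K] has square modulus [H^2 + K^2 = 0]. *)
Lemma upos_anti X : upos X -> upos (- X) -> X = 0.
Proof.
move=> Xp Xn; have [H [[Hs _] HH HC]] := upos_sqrt Xp.
have [K [[Ks _] KK KC]] := upos_sqrt Xn.
have HK : H * K = K * H.
  by apply: KC; rewrite mulrN mulNr -HH mulrA.
pose i := sc 'i : Ad.
have is' : star i = - i by rewrite sc_star -scN conjc_i.
have ii : i * i = -1 by rewrite -scM -expr2 sqr_i scN.
have U0 : H + i * K = 0.
  apply: cstar_eq0; rewrite starD Hs starM is' Ks mulrN -scC.
  have -> : (H - i * K) * (H + i * K) =
      H * H - (i * i) * (K * K) + i * (H * K - K * H)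
      + (H * i - i * H) * K + i * (i * K - K * i) * K.
    by ncring.
  rewrite HK -(scC _ H) -(scC _ K) !subrr !mulr0 mul0r !addr0 ii HH KK.
  by ncring.
have U0' : H - i * K = 0.
  by have := congr1 star U0; rewrite starD Hs starM is' Ks mulrN -scC (bn_star0 NB).
have H0 : H = 0.
  have -> : H = uhalf * ((H + i * K) + (H - i * K)).
    rewrite -[LHS]mul1r -uhalfE; by ncring.
  by rewrite U0 U0' addr0 mulr0.
by rewrite -HH H0 mul0r.
Qed.

(** A self-adjoint element satisfies [N (X^2) = N (X)^2]; this stands in for the
    spectral radius formula. *)
Lemma unorm_pow2 X d k : star X = X -> 0 <= d ->
  unorm (X ^+ (2 ^ k)) <= d ^+ (2 ^ k) -> unorm X <= d.
Proof.
move=> Xs d0; elim: k => [|k IH]; first by rewrite expn0 !expr1.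
rewrite expnSr muln2 -addnn !exprD => h; apply: IH.
apply: unorm_cstar_le; first exact: exprn_ge0.
suff -> : star (X ^+ (2 ^ k)) = X ^+ (2 ^ k) by rewrite expr2.
elim: (2 ^ k)%N => [|n IH]; first by rewrite !expr0 (bn_star1 NB).
by rewrite exprS starM IH Xs -exprSr exprS.
Qed.

Lemma linear_le_exp (K r : R) : 1 < r ->
  exists k, 1 + (2 ^ k)%:R * K <= r ^+ (2 ^ k).
Proof.
move=> r1; pose d := r - 1; have d0 : 0 < d by rewrite /d; lra.
have [n hn] : exists n, 2 * K / (d * d) < n%:R.
  by exists (Num.bound `|2 * K / (d * d)|); apply: le_lt_trans (ler_norm _) (archi_boundP _).
have bern m : 1 + m%:R * d <= r ^+ m.
  elim: m => [|m IH]; first by rewrite mul0r addr0 expr0.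
  rewrite exprS -natr1; have m0 : 0 <= m%:R * d by rewrite mulr_ge0// ltW.
  have : r * (1 + m%:R * d) <= r * r ^+ m by rewrite ler_wpM2l//; lra.
  by rewrite /d in m0 *; nra.
have hn' : 2 * K < (2 ^ n)%:R * (d * d).
  rewrite -ltr_pdivrMr ?mulr_gt0//; apply: lt_le_trans hn _.
  by rewrite ler_nat ltnW// ltn_expl.
exists n.+1; rewrite expnSr muln2 -addnn exprD natrD.
have m0 : 0 <= (2 ^ n)%:R :> R by [].
have := bern (2 ^ n)%N; move: (r ^+ _) ((2 ^ n)%:R) m0 hn' => x m m0 hn' mx.
have m1 : 0 <= m * d by rewrite mulr_ge0// ltW.
have : (1 + m * d) * (1 + m * d) <= x * x by rewrite ler_pM//; lra.
have : m * (2 * K) <= m * (m * (d * d)) by rewrite ler_wpM2l// ltW.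
lra.
Qed.

(** [X^* X] and [X X^*] have the same spectrum up to zero. In terms of norms:
    the powers of [t + X X^*] are [t^m + X g X^*] with [g] a polynomial of degree
    [m - 1] in [X^* X] of norm at most [m t^m], so they exceed [t^m] by a factor
    linear in [m] only, which disappears in the limit of [m]-th roots. *)
Lemma upos_flip X : upos (- (star X * X)) -> upos (- (X * star X)).
Proof.
move=> Xp; have [t0 tX] := upos_large Xp.
(* [1 <= t] lets the bound on [g] be stated with the exponent [m]. *)
pose t := Num.max t0 1; have t1 : 1 <= t by rewrite le_max lexx orbT.
have {}tX : unorm (rsc t + star X * X) <= t.
  by have := tX t; rewrite opprK; apply; rewrite le_max lexx.
have tp : 0 < t by lra.
have Xs : star (rsc t + X * star X) = rsc t + X * star X.
  by rewrite starD rsc_star starM starK.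
split; first by rewrite starN starM starK.
exists t; rewrite opprK.
have pow m : exists g, (rsc t + X * star X) ^+ m = rsc t ^+ m + X * g * star X /\
    unorm g <= m%:R * t ^+ m.
  elim: m => [|m [g [gE gN]]].
    by exists 0; rewrite !expr0 mulr0 mul0r addr0 (bn_0 NB) mul0r.
  exists (rsc t ^+ m + g * (rsc t + star X * X)); split.
    have -> : rsc t ^+ m.+1 = rsc t ^+ m * rsc t by rewrite exprSr.
    rewrite exprSr gE.
    have e : X * rsc t ^+ m = rsc t ^+ m * X.
      by elim: (m) => [|k IH]; rewrite ?expr0 ?mul1r ?mulr1// exprS mulrA -rscC -mulrA IH mulrA.
    have e' : star X * rsc t = rsc t * star X by rewrite rscC.
    move: (star X) (rsc t) e e' => V r e e'.
    have -> : (r ^+ m + X * g * V) * (r + X * V) =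
        r ^+ m * r + X * (r ^+ m + g * (r + V * X)) * V
        + (r ^+ m * X - X * r ^+ m) * V + X * g * (V * r - r * V) by ncring.
    by rewrite e e' !subrr mul0r mulr0 !addr0.
  have Tm := unorm_rscX m (ltW tp).
  apply: le_trans (unorm_D _ _) _.
  have gX : unorm (g * (rsc t + star X * X)) <= m%:R * t ^+ m * t.
    by apply: le_trans (unorm_M _ _) _; rewrite ler_pM// unorm_ge0.
  have tm0 : 0 <= t ^+ m by rewrite exprn_ge0// ltW.
  rewrite exprSr -natr1; nra.
have K0 : 0 <= unorm X * unorm (star X) by rewrite mulr_ge0// unorm_ge0.
have powN m : unorm ((rsc t + X * star X) ^+ m) <=
    t ^+ m * (1 + m%:R * (unorm X * unorm (star X))).
  have [g [-> gN]] := pow m.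
  have Tm := unorm_rscX m (ltW tp).
  apply: le_trans (unorm_D _ _) _; rewrite mulrDr mulr1 lerD//.
  apply: le_trans (unorm_M _ _) _.
  apply: le_trans (ler_wpM2r (unorm_ge0 _) (unorm_M _ _)) _.
  have -> : unorm X * unorm g * unorm (star X) =
    unorm g * (unorm X * unorm (star X)) by ring.
  have -> : t ^+ m * (m%:R * (unorm X * unorm (star X))) =
    (m%:R * t ^+ m) * (unorm X * unorm (star X)) by ring.
  by rewrite ler_wpM2r.
apply/ler_addgt0Pr => e e0.
have r1 : 1 < (t + e) / t by rewrite ltr_pdivlMr// mul1r; lra.
have [k hk] := linear_le_exp (unorm X * unorm (star X)) r1.
apply: (@unorm_pow2 _ _ k Xs); first lra.
apply: le_trans (powN _) _.
have -> : (t + e) ^+ (2 ^ k) = t ^+ (2 ^ k) * ((t + e) / t) ^+ (2 ^ k).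
  by rewrite -exprMn mulrC divfK// gt_eqF.
by rewrite ler_wpM2l// exprn_ge0// ltW.
Qed.

(** Let [h = X^* X] and [k = |h|]. With [c = X (k - h)] one finds
    [c^* c = - (k - h) k (k - h)], which is negative. Then [c c^*] is negative by
    [upos_flip], while [c^* c + c c^*] is twice the sum of the squares of the
    real and imaginary parts of [c]; so [c^* c] is positive as well and vanishes.
    This forces [k (k - h) = 0], hence [(k - h)^2 = 0] and [h = k]. *)
Lemma upos_cstar X : upos (star X * X).
Proof.
pose h := star X * X; have hs : star h = h by rewrite starM starK.
have [k [kp kk kC]] := upos_sqrt (upos_sqr hs); have ks := kp.1.
have hk : h * k = k * h by apply: kC; rewrite mulrA.
have [S [[Ss _] SS SC]] := upos_sqrt kp.
have Sk : k * S = S * k by apply: SC.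
have Sh : h * S = S * h by apply: SC.
pose q := k - h; have qs : star q = q by rewrite starB ks hs.
have Sq : S * q = q * S by rewrite /q mulrBl mulrBr Sk Sh.
pose Z := S * q; have Zs : star Z = Z by rewrite starM Ss qs.
pose c := X * q.
have hqE : h * q = - (k * q) by rewrite mulrBr mulrBr kk hk opprB.
have cc : star c * c = - (Z * Z).
  have -> : star c * c = q * (h * q) by rewrite starM qs /c /h; ncring.
  rewrite hqE /Z {2}Sq mulrA -[S * q * q]mulrA.
  rewrite mulrN -SS; congr (- _).
  have -> : S * (q * q) * S = (S * q) * (q * S) by ncring.
  by rewrite -Sq {1}Sq; ncring.
have cp : upos (- (star c * c)) by rewrite cc opprK; exact: upos_sqr.
have cf := upos_flip cp.
pose u := uhalf * (c + star c); pose v := sc (- 'i) * (uhalf * (c - star c)).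
have hs' : star (uhalf : Ad) = uhalf := bn_star_half NB.
have us : star u = u.
  by rewrite starM hs' starD starK /u (bn_halfC NB) [star c + _]addrC.
have vs : star v = v.
  rewrite sc_starM starM hs' starB starK -(bn_halfC NB) /v.
  have -> : conjc (- 'i) = 'i :> R[i].
    by apply/eqP; rewrite eq_complex /= oppr0 opprK !eqxx.
  by rewrite scN mulNr -[star c - c]opprB !mulrN.
(* [c = u + i v]. *)
have uvE : u * u + v * v + (u * u + v * v) = star c * c + c * star c.
  have ii : - 'i * - 'i = -1 :> R[i] by rewrite mulrNN -expr2 sqr_i.
  rewrite /v scMM ii scN mulN1r /u.
  have hc Y : Y * uhalf = uhalf * Y by rewrite (bn_halfC NB).
  have e Y : (uhalf * Y) * (uhalf * Y) = uhalf * (uhalf * (Y * Y)).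
    by rewrite -[LHS]mulrA [Y * (_ * _)]mulrA hc -!mulrA.
  rewrite !e.
  have -> : uhalf * (uhalf * ((c + star c) * (c + star c))) -
            uhalf * (uhalf * ((c - star c) * (c - star c))) +
           (uhalf * (uhalf * ((c + star c) * (c + star c))) -
            uhalf * (uhalf * ((c - star c) * (c - star c)))) =
      (uhalf + uhalf) * ((uhalf + uhalf) * (star c * c + c * star c)).
    by move: (star c) => d; ncring.
  by rewrite !uhalfE !mul1r.
have pp : upos (star c * c).
  have -> : star c * c = u * u + v * v + (u * u + v * v) + - (c * star c).
    by rewrite uvE addrK.
  have up := upos_sqr us; have vp := upos_sqr vs.
  by do ![apply: upos_add].
have cc0 := upos_anti pp cp.
have Z0 : Z = 0.
  by apply: sa_sqr_eq0 Zs _; apply/eqP; rewrite -oppr_eq0 -cc cc0.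
have kq : k * q = 0 by rewrite -SS -mulrA -/Z Z0 mulr0.
have q0 : q = 0.
  apply: sa_sqr_eq0 qs _.
  by rewrite {1}/q mulrBl hqE opprK kq addr0.
suff -> : star X * X = k by [].
by apply/esym/eqP; rewrite -subr_eq0 -/h -/q q0.
Qed.

End Positivity.

(** * The positive cone of the algebra *)

Section Cone.
Context {R : realType} {A : cstarAlgType R}.
Local Notation Ad := (unitization A).
Implicit Types (a b : A) (X Y : Ad) (t e : R).

Definition emb a : Ad := (a, 0).

Lemma embM a b : emb (cmul a b) = emb a * emb b.
Proof. by congr pair; rewrite /= ?mulr0 // !scale0r !addr0. Qed.

Lemma sndM X Y : (X * Y).2 = X.2 * Y.2. Proof. by []. Qed.

Lemma emb_star a : star (emb a) = emb (star a).
Proof. by congr pair; rewrite /= oppr0. Qed.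

Lemma embD a b : emb (a + b) = emb a + emb b.
Proof. by congr pair; rewrite /= addr0. Qed.

Lemma embZ (z : R[i]) a : emb (z *: a) = sc z * emb a.
Proof. by congr pair; rewrite /= ?mulr0// cmul0l add0r scale0r addr0. Qed.

Lemma emb_inj : injective emb. Proof. by move=> a b []. Qed.

Lemma embK X : X.2 = 0 -> emb X.1 = X.
Proof. by case: X => x z /= ->. Qed.

(** Kaplansky's theorem in one direction and a square root in the other; the
    square root of an element of [A] has no scalar part. *)
Lemma cstar_posP a : cstar_pos a <-> upos (emb a).
Proof.
split=> [[b ->]|]; first by rewrite embM -emb_star; exact: upos_cstar.
move=> /upos_sqrt[H [[Hs _] HH _]].
have H2 : H.2 = 0.
  by have /eqP := congr1 snd HH; rewrite /= mulf_eq0 orbb => /eqP.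
exists H.1; apply: emb_inj.
by rewrite embM -emb_star embK// Hs HH.
Qed.

Lemma cstar_pos_cstar b : cstar_pos (cmul (star b) b).
Proof. by exists b. Qed.

Lemma cstar_posD a b : cstar_pos a -> cstar_pos b -> cstar_pos (a + b).
Proof. by move=> /cstar_posP ap /cstar_posP bp; apply/cstar_posP; rewrite embD; exact: upos_add. Qed.

Lemma cstar_posZ t a : 0 <= t -> cstar_pos a -> cstar_pos (t%:C *: a).
Proof.
move=> t0 [b ->]; exists ((Num.sqrt t)%:C *: b).
rewrite starZ cmulZl cmulZr scalerA conjc_real -rmorphM /=.
by rewrite -expr2 sqr_sqrtr.
Qed.

Lemma cstar_pos_star a : cstar_pos a -> star a = a.
Proof. by move=> [b ->]; rewrite star_cmul starK. Qed.

(** With [Q = (d + a^* a)^(-1)] the product [a (a^* a Q)] differs from [a] by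
    [d a Q], whose squared norm is that of [d^2 Q a^* a Q] and is at most
    [2 d]. *)
Lemma approx_factor a e : 0 < e -> exists b c, nm (a - cmul b c) < e.
Proof.
move=> e0; pose NB := @unorm_banach_star R A.
pose X := emb a; pose P := star X * X.
have Pp : upos P := upos_cstar X.
have [t0 tP] := upos_large Pp.
pose t := Num.max t0 1; have t1 : 1 <= t by rewrite le_max lexx orbT.
have {}tP : unorm (rsc t - P) <= t by apply: tP; rewrite le_max lexx.
pose f := e / 4; pose d := f ^+ 2 / 2.
have d0 : 0 < d by rewrite divr_gt0// exprn_gt0// /f; lra.
have dt : 0 < d + t by lra.
have dtn : d + t != 0 by rewrite gt_eqF.
have dti : 0 <= (d + t)^-1 by rewrite invr_ge0 ltW.
(* [d + P = (d + t) (1 - w)], which a Neumann series inverts. *)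
pose w := rsc (d + t)^-1 * (rsc t - P).
have wN : unorm w <= t / (d + t).
  by apply: le_trans (unorm_rscM _ dti) _; rewrite mulrC ler_wpM2r.
have tdt : t / (d + t) < 1 by rewrite ltr_pdivrMr// mul1r; lra.
have [z [z1 z2 zN]] := bn_neumann NB (le_lt_trans wN tdt).
have {}zN : unorm z <= (d + t) / d.
  apply: le_trans zN _; have n1 := @unorm_1 R A.
  have e1 : 1 - t / (d + t) = d / (d + t) by rewrite -{1}(divff dtn) -mulrBl addrK.
  have e2 : (d + t) / d * (1 - t / (d + t)) = 1.
    by rewrite e1 mulrA divfK ?gt_eqF// divff.
  rewrite ler_pdivrMr; last by lra.
  apply: le_trans n1 _; rewrite -[X in X <= _]e2.
  by apply: ler_wpM2l; [exact: divr_ge0 (ltW dt) (ltW d0)|lra].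
pose Q := rsc (d + t)^-1 * z.
have QN : unorm Q <= d^-1.
  apply: le_trans (unorm_rscM _ dti) _.
  by rewrite -[X in _ <= X](mulKf dtn) ler_wpM2l.
have wE : rsc (d + t) * (1 - w) = rsc d + P.
  by rewrite mulrBr mulr1 rscVK// rscD; ncring.
have QE : (rsc d + P) * Q = 1 by rewrite -wE rscMM z1 divff// mulr1.
have QE' : Q * (rsc d + P) = 1 by rewrite -wE rscMM z2 mulVf// mulr1.
have Qs : star Q = Q.
  by apply: (inverse_star NB QE QE'); rewrite starD rsc_star Pp.1.
have PQ : P * Q = 1 - rsc d * Q by rewrite -QE mulrDl addrAC subrr add0r.
pose D := X - X * (P * Q).
have DE : D = rsc d * (X * Q).
  by rewrite /D PQ mulrBr mulr1 opprB addrC subrK [LHS]mulrA -[X * rsc d]rscC mulrA.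
have DN : unorm D <= f.
  apply: unorm_cstar_le; first by rewrite /f; lra.
  rewrite DE rsc_starM starM Qs rscMM.
  have -> : Q * star X * (X * Q) = Q * (P * Q) by rewrite /P; ncring.
  rewrite PQ mulrBr mulr1.
  have dd0 : 0 <= d * d by rewrite mulr_ge0// ltW.
  apply: le_trans (unorm_rscM _ dd0) _.
  have := bn_B NB Q (Q * (rsc d * Q)).
  have : unorm (Q * (rsc d * Q)) <= d^-1.
    apply: le_trans (unorm_M _ _) _.
    have : unorm (rsc d * Q) <= 1.
      apply: le_trans (unorm_rscM _ (ltW d0)) _.
      by rewrite -(divff (lt0r_neq0 d0)) ler_wpM2l// ltW.
    move=> h; rewrite -[X in _ <= X]mulr1; apply: ler_pM; rewrite ?unorm_ge0//.
  move=> h1 h2.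
  have -> : f ^+ 2 = d * d * (d^-1 + d^-1).
    by rewrite mulrDr mulfK ?lt0r_neq0// /d; lra.
  by rewrite ler_wpM2l//; lra.
exists a, (P * Q).1.
have PQ2 : (P * Q).2 = 0 by rewrite !sndM (_ : X.2 = 0)// mulr0 mul0r.
have -> : a - cmul a (P * Q).1 = D.1.
  by rewrite -[D]/(emb a - emb a * (P * Q)) -(embK PQ2) -embM.
by have := unorm_alg_le D; rewrite /f in DN; lra.
Qed.

End Cone.

(** * The ideal of definition of a trace *)

Section TraceIdeal.
Context {R : realType} {A : cstarAlgType R} {tau : A -> \bar R}.
Hypothesis tau_trace : is_trace tau.
Local Notation Ad := (unitization A).
Implicit Types (a b x y : A) (X Y : Ad) (z w v : R[i]) (t : R).

Let tauW : is_weight tau := tau_trace.1.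

Local Notation fpos := (finite_pos tau).
Local Notation ftau a := (fine (tau a)).

Lemma fposE a : fpos a -> tau a = (ftau a)%:E.
Proof.
move=> [ap afin]; rewrite fineK// ge0_fin_numE//; exact: weight_ge0 tauW _ ap.
Qed.

Lemma fpos0 : fpos 0 /\ ftau 0 = 0.
Proof.
have p0 : cstar_pos (0 : A) by exists 0; rewrite cmul0r.
have t0 : tau 0 = 0%E.
  by have := weightZ tauW (lexx 0) p0; rewrite scaler0 mul0e.
by rewrite /finite_pos /= t0; split=> //; split => //; rewrite ltry.
Qed.

Lemma fposD a b : fpos a -> fpos b -> fpos (a + b) /\ ftau (a + b) = ftau a + ftau b.
Proof.
move=> fa fb; have e := weightD tauW fa.1 fb.1.
rewrite (fposE fa) (fposE fb) -EFinD in e.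
split; last by rewrite e.
by split; [exact: cstar_posD fa.1 fb.1|rewrite e ltry].
Qed.

Lemma fposZ t a : 0 <= t -> fpos a ->
  fpos (t%:C *: a) /\ ftau (t%:C *: a) = t * ftau a.
Proof.
move=> t0 fa; have e := weightZ tauW t0 fa.1.
rewrite (fposE fa) -EFinM in e.
split; last by rewrite e.
by split; [exact: cstar_posZ t0 fa.1|rewrite e ltry].
Qed.

(** The value that an expression of [x] as a linear combination of positive
    elements of finite weight assigns to [x]; it is a relation because its
    single-valuedness is the point to prove. *)
Inductive combination : A -> R[i] -> Prop :=
| combination_nil : combination 0 0
| combination_cons z a x v : fpos a -> combination x v ->
    combination (z *: a + x) (z * (ftau a)%:C + v).

Lemma combinationD x y v w : combination x v -> combination y w ->
  combination (x + y) (v + w).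
Proof.
move=> + yw; elim=> [|z a {}x {}v fa _ IH]; first by rewrite !add0r.
by rewrite -!addrA; exact: combination_cons.
Qed.

Lemma combinationZ z x v : combination x v -> combination (z *: x) (z * v).
Proof.
elim=> [|w a {}x {}v fa _ IH]; first by rewrite scaler0 mulr0; exact: combination_nil.
by rewrite scalerDr mulrDr scalerA mulrA; exact: combination_cons.
Qed.

Lemma combination_star x v : combination x v -> combination (star x) (conjc v).
Proof.
elim=> [|w a {}x {}v fa _ IH]; first by rewrite star0 conjc0; exact: combination_nil.
have -> : conjc (w * (ftau a)%:C + v) = conjc w * (ftau a)%:C + conjc v.
  by case: (w) (v) => [p q] [r s]; apply/eqP; rewrite eq_complex /=;
    apply/andP; split; apply/eqP; ring.
rewrite starD starZ (cstar_pos_star fa.1).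
exact: combination_cons.
Qed.

Lemma combination_fpos a : fpos a -> combination a (ftau a)%:C.
Proof.
move=> fa; have := combination_cons 1 fa combination_nil.
by rewrite scale1r mul1r !addr0.
Qed.

Lemma finite_span_combination x : finite_span tau x <-> exists v, combination x v.
Proof.
split=> [[n [c [a [fa ->]]]]|[v]].
  elim: n c a fa => [|n IH] c a fa.
    by exists 0; rewrite big_ord0; exact: combination_nil.
  rewrite big_ord_recl.
  have [v hv] := IH (fun i => c (lift ord0 i)) _ (fun i => fa (lift ord0 i)).
  by exists (c ord0 * (ftau (a ord0))%:C + v); exact: combination_cons.
elim=> [|z a {}x {}v fa _ [n [c [b [fb ->]]]]].
  by exists 0%N, (fun=> 0), (fun=> 0); split=> [[]//|]; rewrite big_ord0.
exists n.+1, (fun i => if unlift ord0 i is Some j then c j else z),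
  (fun i => if unlift ord0 i is Some j then b j else a); split.
  by move=> i; case: (unlift ord0 i).
rewrite big_ord_recl unlift_none; congr (_ + _).
by apply: eq_bigr => i _; rewrite liftK.
Qed.

Lemma complex_pos_parts z : exists r : 'I_4 -> R, (forall i, 0 <= r i) /\
  z = (r 0)%:C - (r 1)%:C + 'i * ((r 2)%:C - (r 3)%:C).
Proof.
case: z => x y.
exists (fun i => nth 0 [:: Num.max x 0; Num.max (- x) 0; Num.max y 0; Num.max (- y) 0] i).
split; first by case=> [[|[|[|[|]]]]] //= _; rewrite le_max lexx orbT.
have h (u : R) : u = Num.max u 0 - Num.max (- u) 0.
  case: (leP 0 u) => u0; first by rewrite max_r ?subr0//; lra.
  by rewrite max_l; lra.
have := h x; have := h y; rewrite /=.
move: (Num.max x 0) (Num.max (- x) 0) (Num.max y 0) (Num.max (- y) 0) => ? ? ? ? hy hx.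
by apply/eqP; rewrite eq_complex /=; apply/andP; split; apply/eqP; lra.
Qed.

(** Sums of positive elements of finite weight collapse to a single one, so four
    of them suffice. *)
Lemma combination_parts x v : combination x v -> exists p : 'I_4 -> A,
  [/\ forall i, fpos (p i), x = p 0 - p 1 + 'i *: (p 2 - p 3) &
      v = (ftau (p 0))%:C - (ftau (p 1))%:C
          + 'i * ((ftau (p 2))%:C - (ftau (p 3))%:C)].
Proof.
elim=> [|z a {}x {}v fa _ [p [fp -> ->]]].
  exists (fun=> 0); split; first by move=> _; exact: fpos0.1.
    by rewrite !subrr scaler0 addr0.
  by rewrite !subrr mulr0 addr0.
have [r [r0 ->]] := complex_pos_parts z.
have fr i := fposZ (r0 i) fa; have fq i := fposD (fr i).1 (fp i).
exists (fun i => (r i)%:C *: a + p i); split.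
- by move=> i; exact: (fq i).1.
- have sw (b c d e : A) : (b + c) - (d + e) = (b - d) + (c - e).
    by rewrite opprD addrACA.
  by rewrite !sw [X in _ = _ + X]scalerDr scalerDl -scalerA !scalerBl addrACA.
- have e i : (ftau ((r i)%:C *: a + p i))%:C = (r i)%:C * (ftau a)%:C + (ftau (p i))%:C.
    by rewrite (fq i).2 (fr i).2 rmorphD rmorphM.
  by rewrite !e; ring.
Qed.

(** If [p0 - p1 + i (p2 - p3) = 0], taking adjoints separates the real and the
    imaginary part, and [p0 = p1], [p2 = p3]. *)
Lemma combination_zero v : combination 0 v -> v = 0.
Proof.
move=> /combination_parts[p [fp e ->]].
have ps i : star (p i) = p i := cstar_pos_star (fp i).1.
have e' : 0 = p 0 - p 1 - 'i *: (p 2 - p 3).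
  have := congr1 star e; rewrite star0 starD starZ.
  have sB (b c : A) : star (b - c) = star b - star c.
    by rewrite starD; congr (_ + _); apply: (addrI (star c)); rewrite -starD !subrr star0.
  by rewrite !sB !ps conjc_i scaleNr.
have tw0 (b : A) : b + b = 0 -> b = 0.
  move=> h; have : (2 : R[i]) *: b = 0 by rewrite -[2]/(1 + 1) scalerDl !scale1r.
  by move=> /eqP; rewrite scaler_eq0 pnatr_eq0 => /eqP.
have e1 : p 0 - p 1 = 0.
  apply: tw0; move: e e'; move: (p 0 - p 1) ('i *: _) => b c e1 e2.
  have : (b + c) + (b - c) = 0 by rewrite -e1 -e2 addr0.
  by rewrite addrACA subrr addr0.
have e2 : p 2 - p 3 = 0.
  move: e; rewrite e1 add0r => /esym/eqP; rewrite scaler_eq0 => /orP[|/eqP//].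
  by rewrite eq_complex /= oner_eq0 andbF.
by rewrite (subr0_eq e1) (subr0_eq e2) !subrr mulr0 addr0.
Qed.

Lemma combination_uniq x v w : combination x v -> combination x w -> v = w.
Proof.
move=> xv /(combinationZ (-1)) /(combinationD xv).
rewrite scaleN1r subrr mulN1r => /combination_zero /eqP.
by rewrite subr_eq0 => /eqP.
Qed.

Lemma linear_extE x v : combination x v -> linear_ext tau x = v.
Proof.
move=> xv; have ex : exists f, is_linear_ext tau f.
  have cx y : finite_span tau y -> combination y (xget 0 (combination y)).
    by move=> /finite_span_combination[w yw]; apply: xgetPex; exists w.
  exists (fun y => xget 0 (combination y)); split=> [a fa|z y y' fy fy'].
    have ca := combination_fpos fa.
    by apply: (combination_uniq _ ca); apply: xgetPex; exists (ftau a)%:C.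
  have cyy' := combinationD (combinationZ z (cx _ fy)) (cx _ fy').
  apply: (combination_uniq _ cyy'); apply: cx; apply/finite_span_combination.
  by eexists; exact: cyy'.
have [lfpos lD] : is_linear_ext tau (linear_ext tau) := xgetPex _ ex.
have l0 : linear_ext tau 0 = 0.
  have f0 : finite_span tau 0.
    by apply/finite_span_combination; exists 0; exact: combination_nil.
  have := lD 1 0 0 f0 f0; rewrite scale1r addr0 mul1r => /eqP.
  by rewrite eq_sym -subr_eq0 addrK => /eqP.
elim: xv => [//|z a {}x {}v fa xv <-].
have sa : finite_span tau a.
  by apply/finite_span_combination; exists (ftau a)%:C; exact: combination_fpos.
have sx : finite_span tau x by apply/finite_span_combination; exists v.
by rewrite (lD _ _ _ sa sx) lfpos.
Qed.

Local Notation span := (finite_span tau).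
Local Notation ltau := (linear_ext tau).

Lemma span_ltau x : span x -> combination x (ltau x).
Proof. by move=> /finite_span_combination[v xv]; rewrite (linear_extE xv). Qed.

Lemma spanW x v : combination x v -> span x.
Proof. by move=> xv; apply/finite_span_combination; exists v. Qed.

Lemma span0 : span 0. Proof. exact: spanW combination_nil. Qed.

Lemma spanD x y : span x -> span y -> span (x + y).
Proof. by move=> /span_ltau hx /span_ltau hy; exact: spanW (combinationD hx hy). Qed.

Lemma spanZ z x : span x -> span (z *: x).
Proof. by move=> /span_ltau hx; exact: spanW (combinationZ z hx). Qed.

Lemma spanN x : span x -> span (- x).
Proof. by move=> /(spanZ (-1)); rewrite scaleN1r. Qed.

Lemma span_star x : span x -> span (star x).
Proof. by move=> /span_ltau hx; exact: spanW (combination_star hx). Qed.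

Lemma ltau0 : ltau 0 = 0. Proof. exact: linear_extE combination_nil. Qed.

Lemma ltauD x y : span x -> span y -> ltau (x + y) = ltau x + ltau y.
Proof. by move=> /span_ltau hx /span_ltau hy; exact: linear_extE (combinationD hx hy). Qed.

Lemma ltauZ z x : span x -> ltau (z *: x) = z * ltau x.
Proof. by move=> /span_ltau hx; exact: linear_extE (combinationZ z hx). Qed.

Lemma ltau_star x : span x -> ltau (star x) = conjc (ltau x).
Proof. by move=> /span_ltau hx; exact: linear_extE (combination_star hx). Qed.

Lemma fpos_span a : fpos a -> span a.
Proof. by move=> /combination_fpos; exact: spanW. Qed.

(** The analogue of Hilbert-Schmidt operators: the left ideal usually written
    [N_tau]. *)
Definition hilbert_schmidt x : Prop := fpos (cmul (star x) x).

Lemma fpos_le a b : cstar_pos a -> cstar_pos b -> fpos (a + b) -> fpos a.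
Proof.
move=> ap bp [_]; rewrite (weightD tauW ap bp) => h; split=> //.
apply: le_lt_trans h; rewrite leeDl//; exact: weight_ge0 tauW _ bp.
Qed.

Lemma tau_swap x : tau (cmul x (star x)) = tau (cmul (star x) x).
Proof. exact: tau_trace.2. Qed.

Lemma hs_star x : hilbert_schmidt x -> hilbert_schmidt (star x).
Proof.
move=> [_ h]; split; first exact: cstar_pos_cstar.
by rewrite starK tau_swap.
Qed.

Lemma hsE x : hilbert_schmidt x <-> fpos (cmul x (star x)).
Proof.
split=> [/hs_star|]; first by rewrite /hilbert_schmidt starK.
by rewrite -{1}[x]starK => /hs_star; rewrite starK.
Qed.

Lemma hsZ z x : hilbert_schmidt x -> hilbert_schmidt (z *: x).
Proof.
move=> hx; rewrite /hilbert_schmidt starZ cmulZl cmulZr scalerA.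
have -> : conjc z * z = (nm z ^+ 2)%:C.
  by rewrite mulrC -sqr_normc nmE rmorphXn.
by apply: (fposZ _ hx).1; rewrite exprn_ge0// nm_ge0.
Qed.

(** The parallelogram law bounds [(x + y)^* (x + y)] by [2 x^* x + 2 y^* y]. *)
Lemma hsD x y : hilbert_schmidt x -> hilbert_schmidt y -> hilbert_schmidt (x + y).
Proof.
move=> hx hy; apply: (@fpos_le _ (cmul (star (x - y)) (x - y))); try exact: cstar_pos_cstar.
have := (fposD (fposD hx hx).1 (fposD hy hy).1).1.
congr (fpos _); apply: emb_inj.
rewrite !embD !embM -!emb_star.
have -> : emb (x - y) = emb x - emb y by congr pair; rewrite subr0.
rewrite embD starB starD; move: (star (emb x)) (star (emb y)) => a b.
ncring.
Qed.

(** For large [c] the element [c - X X^*] is a square [r r^*], hence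
    [x X X^* x^* <= c x x^*]. *)
Lemma hs_mulr x X : hilbert_schmidt x -> hilbert_schmidt (emb x * X).1.
Proof.
move=> /hsE hx; apply/hsE; pose NB := @unorm_banach_star R A.
pose P := X * star X; have P0 := unorm_ge0 P.
have Ps : star P = P by rewrite starM starK.
pose c := unorm P + 1; have c0 : 0 < c by rewrite /c; lra.
have w1 : unorm (rsc c^-1 * P) <= 1.
  have ci : 0 <= c^-1 by rewrite invr_ge0 ltW.
  apply: le_trans (unorm_rscM _ ci) _.
  by rewrite -(mulVf (lt0r_neq0 c0)) ler_wpM2l// /c; lra.
have [y [yE _ _ ys]] := bn_sqrt NB w1 (lexx 1).
have {}ys : star y = y by apply: ys; rewrite rsc_starM Ps.
pose r := rsc (Num.sqrt c) * (1 - y).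
have rs : star r = r by rewrite rsc_starM starB (bn_star1 NB) ys.
have rr : r * r = rsc c - P.
  rewrite rscMM -expr2 sqr_sqrtr ?ltW//.
  have -> : (1 - y) * (1 - y) = 1 - (y + y) + y * y by ncring.
  rewrite yE; have -> : 1 - (rsc c^-1 * P + y * y) + y * y = 1 - rsc c^-1 * P by ncring.
  by rewrite mulrBr mulr1 rscVK// gt_eqF.
have m2 Y : (emb x * Y).2 = 0 by rewrite sndM mul0r.
have pE Y : emb (cmul (emb x * Y).1 (star (emb x * Y).1)) = emb x * (Y * star Y) * star (emb x).
  by rewrite embM -emb_star embK// starM; ncring.
apply: (@fpos_le _ (cmul (emb x * r).1 (star (emb x * r).1))).
- by rewrite -{1}(starK (emb x * X).1); exact: cstar_pos_cstar.
- by rewrite -{1}(starK (emb x * r).1); exact: cstar_pos_cstar.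
have := (fposZ (ltW c0) hx).1.
congr (fpos _); apply: emb_inj; rewrite embD !pE rs rr embZ embM -emb_star -/(rsc c).
rewrite -/P.
have -> : emb x * P * star (emb x) + emb x * (rsc c - P) * star (emb x) =
  (emb x * rsc c) * star (emb x) by ncring.
by rewrite -rscC mulrA.
Qed.

Lemma hs_mull x X : hilbert_schmidt x -> hilbert_schmidt (X * emb x).1.
Proof.
move=> /hs_star /(@hs_mulr _ (star X)) /hs_star.
by rewrite -emb_star -starM /= starK.
Qed.

Lemma polarization X Y (i := sc 'i : Ad) :
  star (X + Y) * (X + Y) + i * (star (X + i * Y) * (X + i * Y))
  - star (X - Y) * (X - Y) - i * (star (X - i * Y) * (X - i * Y)) =
  star Y * X + star Y * X + (star Y * X + star Y * X).
Proof.
rewrite !(starD, starN, starM) sc_star conjc_i scN -/i.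
have ii : i * i = -1 by rewrite -scM -expr2 sqr_i scN.
rewrite !mulrN -!(scC _ (star Y)) -/i.
move: (star X) (star Y) => a b.
have ia : a * i = i * a by rewrite scC.
have ib : b * i = i * b by rewrite scC.
have -> : (a + b) * (X + Y) + i * ((a - i * b) * (X + i * Y)) -
    (a - b) * (X - Y) - i * ((a - - (i * b)) * (X - i * Y)) =
   a * Y + a * Y + (b * X + b * X)
   + (i * (a * i) * (Y + Y)) - (i * i) * b * (X + X).
  by ncring.
rewrite ia [i * (i * a)]mulrA ii; ncring.
Qed.

Lemma polarization_star X Y (i := sc 'i : Ad) :
  (X + Y) * star (X + Y) + i * ((X + i * Y) * star (X + i * Y))
  - (X - Y) * star (X - Y) - i * ((X - i * Y) * star (X - i * Y)) =
  X * star Y + X * star Y + (X * star Y + X * star Y).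
Proof.
rewrite !(starD, starN, starM) sc_star conjc_i scN -/i.
have ii : i * i = -1 by rewrite -scM -expr2 sqr_i scN.
rewrite !mulrN -!(scC _ (star Y)) -/i.
move: (star X) (star Y) => a b.
have iX : X * i = i * X by rewrite scC.
have iY : Y * i = i * Y by rewrite scC.
have -> : (X + Y) * (a + b) + i * ((X + i * Y) * (a - i * b)) -
    (X - Y) * (a - b) - i * ((X - i * Y) * (a - - (i * b))) =
   X * b + X * b + (Y * a + Y * a)
   + (i * i) * (Y + Y) * a - i * (X * i) * (b + b).
  by ncring.
rewrite iX [i * (i * X)]mulrA ii; ncring.
Qed.

Lemma cmul_polarization x y :
  4%:R *: cmul (star y) x =
    cmul (star (x + y)) (x + y) + 'i *: cmul (star (x + 'i *: y)) (x + 'i *: y)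
    - cmul (star (x - y)) (x - y)
    - 'i *: cmul (star (x - 'i *: y)) (x - 'i *: y).
Proof.
have embN a : emb (- a) = - emb a by congr pair; rewrite oppr0.
apply: emb_inj; rewrite scaler_nat !mulrS mulr0n addr0.
rewrite !(embD, embN, embZ, embM) -!emb_star !(embD, embN, embZ) polarization.
by rewrite !addrA.
Qed.

Lemma cmul_polarization_star x y :
  4%:R *: cmul x (star y) =
    cmul (x + y) (star (x + y)) + 'i *: cmul (x + 'i *: y) (star (x + 'i *: y))
    - cmul (x - y) (star (x - y))
    - 'i *: cmul (x - 'i *: y) (star (x - 'i *: y)).
Proof.
have embN a : emb (- a) = - emb a by congr pair; rewrite oppr0.
apply: emb_inj; rewrite scaler_nat !mulrS mulr0n addr0.
rewrite !(embD, embN, embZ, embM) -!emb_star !(embD, embN, embZ) polarization_star.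
by rewrite !addrA.
Qed.

(** Both products are the same combination of the elements [z^* z], respectively
    [z z^*], with [z = x + i^k y], and the trace does not distinguish these. *)
Lemma hs_mul x y : hilbert_schmidt x -> hilbert_schmidt y ->
  [/\ span (cmul (star y) x), span (cmul x (star y)) &
      ltau (cmul (star y) x) = ltau (cmul x (star y))].
Proof.
move=> hx hy.
have hN a : hilbert_schmidt a -> hilbert_schmidt (- a) by move=> /(hsZ (-1)); rewrite scaleN1r.
have h1 := hsD hx hy; have h2 := hsD hx (hsZ 'i hy).
have h3 := hsD hx (hN _ hy); have h4 := hsD hx (hN _ (hsZ 'i hy)).
pose comb (a b c d : A) := a + 'i *: b - c - 'i *: d.
have cE a b c d : fpos a -> fpos b -> fpos c -> fpos d ->
    combination (comb a b c d)
      ((ftau a)%:C + 'i * (ftau b)%:C - (ftau c)%:C - 'i * (ftau d)%:C).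
  move=> fa fb fc fd; have hc z e (fe : fpos e) := combinationZ z (combination_fpos fe).
  have := combinationD (combinationD (combinationD (combination_fpos fa) (hc 'i _ fb))
    (hc (-1) _ fc)) (hc (- 'i) _ fd).
  by rewrite !scaleN1r !scaleNr mulN1r mulNr.
have q4 : (4%:R^-1 * 4%:R : R[i]) = 1 by rewrite mulVf// pnatr_eq0.
have quarter a b w : 4%:R *: a = b -> combination b w -> combination a (4%:R^-1 * w).
  by move=> <- /(combinationZ (4%:R^-1)); rewrite scalerA q4 scale1r.
have c1 := quarter _ _ _ (cmul_polarization x y) (cE _ _ _ _ h1 h2 h3 h4).
have {}c2 := quarter _ _ _ (cmul_polarization_star x y)
  (cE _ _ _ _ ((hsE _).1 h1) ((hsE _).1 h2) ((hsE _).1 h3) ((hsE _).1 h4)).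
split; [exact: spanW c1|exact: spanW c2|].
by rewrite (linear_extE c1) (linear_extE c2) !tau_swap.
Qed.

(** A positive element of finite weight is [b^* b] with [b] Hilbert-Schmidt. Then
    [b^* b X] and [X b^* b], bracketed suitably, are products of two
    Hilbert-Schmidt elements, and moving factors with [hs_mul] turns one trace
    into the other. *)
Lemma span_ideal x X : span x ->
  [/\ span (emb x * X).1, span (X * emb x).1 &
      ltau (emb x * X).1 = ltau (X * emb x).1].
Proof.
move=> /span_ltau; elim=> [|z a {}x _ fa _ [IH1 IH2 IH3]].
  have -> : emb 0 = 0 by [].
  by rewrite mul0r mulr0; split; [exact: span0|exact: span0|].
have [b ab] := fa.1; have hb : hilbert_schmidt b by rewrite /hilbert_schmidt -ab.
have scE Y : (sc z * Y).1 = z *: Y.1.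
  by rewrite /= cmul0l scaler0 add0r addr0.
have -> : emb (z *: a + x) = sc z * emb a + emb x by rewrite embD embZ.
rewrite mulrDl mulrDr -!mulrA [X * (sc z * _)]mulrA -scC -mulrA.
rewrite -[(_ + emb x * X).1]/((sc z * (emb a * X)).1 + (emb x * X).1).
rewrite -[(_ + X * emb x).1]/((sc z * (X * emb a)).1 + (X * emb x).1).
rewrite !scE.
have e1 : emb (emb b * X).1 = emb b * X by rewrite embK// sndM mul0r.
have e2 : emb (X * emb (star b)).1 = X * emb (star b) by rewrite embK// sndM mulr0.
have E1 : (emb a * X).1 = cmul (star b) (emb b * X).1.
  rewrite ab; apply: emb_inj; rewrite [in RHS]embM e1 embK ?sndM ?mul0r//.
  by rewrite embM mulrA.
have E2 : (X * emb a).1 = cmul (X * emb (star b)).1 b.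
  rewrite ab; apply: emb_inj; rewrite [in RHS]embM e2 embK ?sndM ?mulr0//.
  by rewrite embM mulrA.
have E3 : cmul (emb b * X).1 (star b) = cmul b (X * emb (star b)).1.
  by apply: emb_inj; rewrite !embM e1 e2 mulrA.
have [s1 _ t1] := hs_mul (hs_mulr X hb) hb.
have [s2 s3 t2] := hs_mul (hs_mull X (hs_star hb)) (hs_star hb).
rewrite starK in s2 s3 t2; rewrite -E1 in s1 t1; rewrite -E2 in s3 t2.
split; [exact: spanD (spanZ _ s1) IH1|exact: spanD (spanZ _ s3) IH2|].
by rewrite (ltauD (spanZ z s1) IH1) (ltauD (spanZ z s3) IH2) !ltauZ// IH3 t1 E3 t2.
Qed.

(** Elements of [A] are nearly products, products are combinations of positive
    elements, and these are limits of elements of finite weight. *)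
Lemma span_dense (tau_dense : densely_defined tau) x e : 0 < e ->
  exists y, span y /\ nm (x - y) < e.
Proof.
move=> e0.
have dense a : cstar_pos a -> exists p, fpos p /\ nm (a - p) < e / 4.
  move=> /tau_dense ap; have e2 : 0 < (e / 4)%:C :> R[i] by rewrite ltcR; lra.
  have [p [fp bp]] := ap _ (nbhsx_ballx a _ e2).
  by exists p; split=> //; move: bp; rewrite -ball_normE /= nmE ltcR.
have e2 : 0 < e / 2 by lra.
have [b [c bc]] := approx_factor x e2.
pose y := star b; rewrite -[b]starK -/y in bc.
have [p1 [f1 n1]] := dense _ (cstar_pos_cstar (c + y)).
have [p2 [f2 n2]] := dense _ (cstar_pos_cstar (c + 'i *: y)).
have [p3 [f3 n3]] := dense _ (cstar_pos_cstar (c - y)).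
have [p4 [f4 n4]] := dense _ (cstar_pos_cstar (c - 'i *: y)).
pose p := p1 + 'i *: p2 - p3 - 'i *: p4.
exists (4%:R^-1 *: p); split.
  apply: spanZ; do !apply: spanD; try apply: spanN; try apply: spanZ; exact: fpos_span.
have q4 : (4%:R^-1 * 4%:R : R[i]) = 1 by rewrite mulVf// pnatr_eq0.
have -> q : x - 4%:R^-1 *: q = (x - cmul (star y) c) +
    4%:R^-1 *: (4%:R *: cmul (star y) c - q).
  by rewrite scalerBr scalerA q4 scale1r addrA subrK.
apply: le_lt_trans (nm_D _ _) _.
have i1 : nm ('i : R[i]) = 1 by rewrite /nm normc_def /= expr0n expr1n add0r sqrtr1.
have n4' : nm (4%:R^-1 : R[i]) = 4^-1.
  have -> : (4%:R^-1 : R[i]) = (4^-1)%:C by rewrite fmorphV rmorph_nat.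
  by rewrite nm_real ger0_norm.
rewrite nm_Z n4' cmul_polarization /p.
move: n1 n2 n3 n4; move: (cmul _ _) (cmul _ _) (cmul _ _) (cmul _ _).
move=> a4 a3 a2 a1 n1 n2 n3 n4.
have -> : a1 + 'i *: a2 - a3 - 'i *: a4 - (p1 + 'i *: p2 - p3 - 'i *: p4) =
    (a1 - p1) + 'i *: (a2 - p2) - (a3 - p3) - 'i *: (a4 - p4).
  rewrite !scalerBr !opprD !opprK !addrA.
  by rewrite [LHS](ACl (1*5*2*6*3*7*4*8)%AC).
have h1 := nm_B (a1 - p1 + 'i *: (a2 - p2) - (a3 - p3)) ('i *: (a4 - p4)).
have h2 := nm_B (a1 - p1 + 'i *: (a2 - p2)) (a3 - p3).
have h3 := nm_D (a1 - p1) ('i *: (a2 - p2)).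
rewrite !nm_Z i1 !mul1r in h1 h2 h3.
lra.
Qed.

End TraceIdeal.

(** * Projections near approximate projections *)

Section RingIdentities.
Variable B : pzRingType.

Lemma half_symmetrization (h x y p : B) : h + h = 1 ->
  h * ((x - p) + (y - p)) = h * (x + y) - p.
Proof.
move=> hh; have -> : h * (x - p + (y - p)) = h * (x + y) - (h + h) * p by ncring.
by rewrite hh mul1r.
Qed.

Lemma sub_sqr_near_idempotent (p y : B) : p * p = p ->
  y - y * y = (y - p) - p * (y - p) - (y - p) * p - (y - p) * (y - p).
Proof.
move=> pp; have -> : y - p - p * (y - p) - (y - p) * p - (y - p) * (y - p) =
  y - y * y - (p - p * p) by ncring.
by rewrite pp subrr subr0.
Qed.

End RingIdentities.

Section NearProjection.
Context {R : realType} {B : pzRingType} (N : B -> R) (s : B -> B) (h : B).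
Hypothesis NB : banach_star N s h.

(** [1 - w = 4 (x - h)^2], so [q = h + (x - h) (1 - w)^(-1/2)] is the spectral
    projection of [x] for the part of the spectrum above one half. It is written
    as [x] plus a multiple of [w] for the sake of ideals that contain [w]. *)
Lemma bn_projection_near p e : p * p = p -> 0 < e -> exists d, 0 < d /\
  forall x, s x = x -> N (x - p) <= d ->
  let w := (x - x * x) + (x - x * x) + ((x - x * x) + (x - x * x)) in
  exists z, let q := x + (x - h) * (w * z) in
    [/\ q * q = q, s q = q & N (q - p) <= e].
Proof.
move=> pp e0.
pose K := N p + N 1 + 1.
have p0 := bn_ge0 NB p; have n0 := bn_ge0 NB 1.
have K1 : 1 <= K by rewrite /K; lra.
have K4 : 1 <= K ^+ 4 by rewrite exprn_ege1.
(* The first bound gives [N w <= 1/4], the second one collects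
   [N (x - p) <= d] and [N ((x - h) w z) <= 3 K * 16 K d * K^2]. *)
pose d := Num.min (1 / (64 * K)) (e / (97 * K ^+ 4)).
have d0 : 0 < d by rewrite lt_min; apply/andP; split; rewrite divr_gt0//; lra.
exists d; split=> // x xs xp w.
have dK : d * K <= 1 / 64.
  have : d <= 1 / (64 * K) by rewrite ge_min lexx.
  rewrite ler_pdivlMr; [lra|lra].
have dK4 : d * K ^+ 4 <= e / 97.
  have : d <= e / (97 * K ^+ 4) by rewrite ge_min lexx orbT.
  rewrite ler_pdivlMr; [lra|lra].
pose c := x - p; have c0 := bn_ge0 NB c; have cd : N c <= d := xp.
have d1 : d <= 1 by nra.
have uE : x - x * x = c - p * c - c * p - c * c := sub_sqr_near_idempotent x pp.
have uN : N (x - x * x) <= 4 * K * d.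
  rewrite uE; have := bn_B NB (c - p * c - c * p) (c * c).
  have := bn_B NB (c - p * c) (c * p); have := bn_B NB c (p * c).
  have := bn_M NB p c; have := bn_M NB c p; have := bn_M NB c c.
  have : N p * N c <= K * d by rewrite ler_pM// /K; lra.
  have : N c * N c <= 1 * d by rewrite ler_pM//; lra.
  have : 1 * d <= K * d by rewrite ler_wpM2r// ltW.
  lra.
have wN : N w <= 16 * K * d by rewrite /w !(bn_double NB); lra.
have w4 : N w <= 1 / 4 by lra.
have [z [zE zN zC zs]] := bn_inverse_sqrt NB w4.
have xw : x * w = w * x by rewrite /w; ncring.
have xz := zC x xw.
have ws : s w = w.
  by rewrite /w !(bn_starD NB) (bn_starN NB) (bn_starM NB) xs.
have wE : w = (x - x * x) + (x - x * x) + ((x - x * x) + (x - x * x)) by [].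
clearbody w.
have {}zs := zs ws; have wz : w * z = z * w by apply: zC.
have hC y : h * y = y * h := bn_halfC NB y.
have hh := bn_halfE NB.
exists z => q.
pose g := 1 + w * z.
have xg : x * g = g * x by rewrite /g mulrDr mulrDl mulr1 mul1r mulrA xw -!mulrA xz.
have qE : q = h + (x - h) * g by rewrite /q /g mulrDr mulr1; ncring.
pose y := x - h.
have yg : y * g = g * y by rewrite /y mulrBl mulrBr xg hC.
have yy : y * y = (h * h) * (1 - w).
  have -> : (h * h) * (1 - w) = h * h - (h + h) * (h + h) * (x - x * x).
    by rewrite wE; ncring.
  rewrite hh !mul1r.
  have -> : y * y = x * x - (h * x + x * h) + h * h by rewrite /y; ncring.
  by rewrite -(hC x) -mulrDl hh mul1r; ncring.
split.
- rewrite qE -/y.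
  have -> : (h + y * g) * (h + y * g) =
      h * h + h * (y * g) + (y * g) * h + y * (g * y) * g by ncring.
  rewrite -yg -(hC (y * g)).
  have -> : y * (y * g) * g = (y * y) * (g * g) by ncring.
  rewrite yy -[h * h * (1 - w) * _]mulrA zE mulr1.
  have -> : h * h + h * (y * g) + h * (y * g) + h * h =
     (h + h) * (h + y * g) by ncring.
  by rewrite hh mul1r.
- rewrite /q (bn_starD NB) !(bn_starM NB) zs ws (bn_starD NB) (bn_starN NB) xs.
  rewrite (bn_star_half NB); congr (_ + _).
  have wzx : w * z * x = x * (w * z) by rewrite -mulrA -xz mulrA -xw mulrA.
  by rewrite -wz mulrBr mulrBl wzx hC.
have -> : q - p = c + (x - h) * (w * z) by rewrite /q /c; ncring.
have h1 := bn_D NB c ((x - h) * (w * z)).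
have h2 := bn_M NB (x - h) (w * z).
have h3 := bn_M NB w z.
have h4 : N (x - h) <= 3 * K.
  have := bn_B NB x h; have := bn_D NB c p.
  have -> : c + p = x by rewrite /c; ncring.
  have := bn_half NB 1; rewrite mulr1 /K; lra.
have zK : N z <= K * K.
  apply: le_trans zN _; rewrite expr2 ler_pM// /K; lra.
have h5 : N w * N z <= 16 * K * d * (K * K) by rewrite ler_pM// (bn_ge0 NB).
have h6 : N (x - h) * N (w * z) <= 3 * K * (16 * K * d * (K * K)).
  by rewrite ler_pM ?(bn_ge0 NB)//; lra.
have h7 : d <= d * K ^+ 4 by rewrite ler_peMr// ltW.
have -> : e = 97 * (e / 97) by lra.
have : 3 * K * (16 * K * d * (K * K)) = 48 * (d * K ^+ 4) by ring.
lra.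
Qed.

End NearProjection.

(** * Matrices over the unitization *)

Section MatrixNorm.
Context {R : realType} {A : cstarAlgType R}.
Local Notation Ad := (unitization A).

(** Any complete submultiplicative norm serves; the sum of the norms of the
    entries makes all estimates immediate. *)
Definition mnorm m n (X : 'M[Ad]_(m, n)) : R := \sum_i \sum_j unorm (X i j).

Lemma mnorm_entry m n (X : 'M[Ad]_(m, n)) i j : unorm (X i j) <= mnorm X.
Proof.
rewrite /mnorm (bigD1 i)//= (bigD1 j)//= -addrA lerDl addr_ge0//.
  by rewrite sumr_ge0// => *; exact: unorm_ge0.
by rewrite sumr_ge0// => *; rewrite sumr_ge0// => *; exact: unorm_ge0.
Qed.

Lemma mnorm_ge0 m n (X : 'M[Ad]_(m, n)) : 0 <= mnorm X.
Proof. by rewrite sumr_ge0// => *; rewrite sumr_ge0// => *; exact: unorm_ge0. Qed.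

Lemma mnormD m n (X Y : 'M[Ad]_(m, n)) : mnorm (X + Y) <= mnorm X + mnorm Y.
Proof.
rewrite /mnorm -big_split ler_sum// => i _; rewrite -big_split ler_sum// => j _.
by rewrite mxE unorm_D.
Qed.

Lemma mnormN m n (X : 'M[Ad]_(m, n)) : mnorm (- X) = mnorm X.
Proof. by apply: eq_bigr => i _; apply: eq_bigr => j _; rewrite mxE unorm_N. Qed.

Lemma mnormM m n k (X : 'M[Ad]_(m, n)) (Y : 'M[Ad]_(n, k)) :
  mnorm (X *m Y) <= mnorm X * mnorm Y.
Proof.
rewrite {1}/mnorm {1}/mnorm mulr_suml ler_sum// => i _.
apply: le_trans (_ : \sum_j \sum_l unorm (X i l) * unorm (Y l j) <= _).
  rewrite ler_sum// => j _; rewrite mxE.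
  elim/big_ind2 : _ => [|a a' b b' ha hb|l _]; last exact: unorm_M.
    by rewrite (bn_0 unorm_banach_star).
  exact: le_trans (unorm_D _ _) (lerD ha hb).
rewrite exchange_big mulr_suml ler_sum//= => l _; rewrite -mulr_sumr.
rewrite ler_wpM2l ?unorm_ge0// /mnorm [X in _ <= X](bigD1 l)//= lerDl.
by rewrite sumr_ge0// => *; rewrite sumr_ge0// => *; exact: unorm_ge0.
Qed.

Lemma mnorm_madj m n (X : 'M[Ad]_(m, n)) : mnorm (madj X) = mnorm X.
Proof.
rewrite /mnorm exchange_big; apply: eq_bigr => i _; apply: eq_bigr => j _.
by rewrite !mxE unorm_star.
Qed.

Lemma madjD m n (X Y : 'M[Ad]_(m, n)) : madj (X + Y) = madj X + madj Y.
Proof. by apply/matrixP => i j; rewrite !mxE starD. Qed.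

Lemma madjN m n (X : 'M[Ad]_(m, n)) : madj (- X) = - madj X.
Proof. by apply/matrixP => i j; rewrite !mxE starN. Qed.

Lemma sum_vanishing (I : finType) (f : I -> nat -> R) :
  (forall i e, 0 < e -> exists n, forall p, (n <= p)%N -> f i p < e) ->
  forall e, 0 < e -> exists n, forall p, (n <= p)%N -> \sum_i f i p < e.
Proof.
move=> fP e e0; pose c := e / (#|I|%:R + 1).
have I0 : 0 <= #|I|%:R :> R by [].
have c0 : 0 < c by rewrite divr_gt0//; lra.
have [n hn] := choice (fun i => fP i _ c0).
exists (\max_i n i) => p np.
apply: le_lt_trans (_ : \sum_(i : I) c < _).
  by rewrite ler_sum// => i _; apply/ltW/hn; apply: leq_trans np; exact: leq_bigmax.
have : c * (#|I|%:R + 1) = e by rewrite divfK//; lra.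
by rewrite sumr_const -mulr_natr; lra.
Qed.

Lemma mnorm_complete m n (u : nat -> 'M[Ad]_(m, n)) :
  (forall e, 0 < e -> exists n, forall p q, (n <= p)%N -> (n <= q)%N ->
     mnorm (u p - u q) < e) ->
  exists l, forall e, 0 < e -> exists n, forall p, (n <= p)%N ->
     mnorm (u p - l) < e.
Proof.
move=> uC.
have lim (ij : 'I_m * 'I_n) : exists l, forall e, 0 < e -> exists k, forall p,
    (k <= p)%N -> unorm (u p ij.1 ij.2 - l) < e.
  apply: unorm_complete => e /uC[k hk]; exists k => p q kp kq.
  apply: le_lt_trans (hk _ _ kp kq).
  by have := mnorm_entry (u p - u q) ij.1 ij.2; rewrite !mxE.
have [l hl] := choice lim.
exists (\matrix_(i, j) l (i, j)) => e e0.
have [k hk] := sum_vanishing hl e0; exists k => p /hk.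
rewrite /mnorm pair_bigA /=; congr (_ < _).
by apply: eq_bigr => -[i j] _; rewrite !mxE.
Qed.

Lemma mnorm_banach_star n :
  banach_star (fun X : 'M[Ad]_n => mnorm X) (fun X => madj X) (uhalf%:M).
Proof.
split.
- exact: mnormD.
- exact: mnormN.
- exact: mnormM.
- move=> X; rewrite /mnorm -big_split; apply: eq_bigr => i _; rewrite -big_split.
  by apply: eq_bigr => j _; rewrite mxE unorm_double.
- move=> X X0; apply/matrixP => i j; rewrite mxE; apply: unorm_eq0; apply/eqP.
  by rewrite eq_le unorm_ge0 andbT -X0 mnorm_entry.
- exact: mnorm_complete.
- by rewrite -raddfD /= uhalfE.
- exact: madjD.
- exact: madjM.
- exact: madjK.
- exact: mnorm_madj.
Qed.

Lemma madj1 n : madj (1%:M : 'M[Ad]_n) = 1%:M.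
Proof. exact: bn_star1 (mnorm_banach_star n). Qed.

(** [V] is almost a partial isometry from [F] to [E]; [W] is its polar part
    [(1 - r)^(-1/2) V]. Then [W^* W] acts as the identity on [V^*], hence on
    [V^* V], and this is invertible under [F]. *)
Lemma polar m n (E : 'M[Ad]_m) (F : 'M[Ad]_n) (V : 'M[Ad]_(m, n))
    (r := E - V *m madj V) (r' := F - madj V *m V) :
  is_proj E -> is_proj F -> E *m V = V -> V *m F = V ->
  mnorm r <= 1 / 4 -> mnorm r' <= 1 / 4 ->
  exists z, let W := (1%:M + r *m z) *m V in
    W *m madj W = E /\ madj W *m W = F.
Proof.
move=> /andP[/eqP EE /eqP Es] /andP[/eqP FF /eqP Fs] EV VF r4 r4'.
have sV : madj V *m E = madj V by rewrite -{2}EV madjM Es.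
have FV : F *m madj V = madj V by rewrite -{2}VF madjM Fs.
have rs : madj r = r by rewrite madjD madjN madjM madjK Es.
have Er : E *m r = r by rewrite mulmxBr EE mulmxA EV.
have rE : r *m E = r by rewrite mulmxBl EE -mulmxA sV.
have [z [zE _ zC zs]] := bn_inverse_sqrt (mnorm_banach_star m) r4.
have {}zs : madj z = z := zs rs.
have rz : r *m z = z *m r := zC r erefl.
have Ez : E *m z = z *m E by apply: zC; rewrite -[LHS]/(E *m r) -[RHS]/(r *m E) Er rE.
pose g : 'M[Ad]_m := 1%:M + r *m z.
have gE : (1%:M - r) *m (g *m g) = 1%:M := zE.
have gs : madj g = g by rewrite madjD madj1 madjM zs rs -rz.
have gr : g *m r = r *m g.
  by rewrite /g mulmxDl mulmxDr mul1mx mulmx1 -mulmxA -rz.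
have Eg : E *m g = g *m E.
  by rewrite /g mulmxDl mulmxDr mul1mx mulmx1 mulmxA Er -mulmxA -Ez mulmxA rE.
have VV : V *m madj V = E *m (1%:M - r).
  by rewrite mulmxBr mulmx1 Er /r opprB addrC subrK.
have g1 : g *m (1%:M - r) = (1%:M - r) *m g.
  by rewrite mulmxBr mulmxBl mulmx1 mul1mx gr.
exists z => W; rewrite -/g in W *.
have WW : madj W *m W = madj V *m (g *m g) *m V.
  by rewrite madjM gs !mulmxA.
split.
  have -> : W *m madj W = g *m (V *m madj V) *m g by rewrite madjM gs !mulmxA.
  by rewrite VV mulmxA -Eg -!mulmxA [g *m (_ *m g)]mulmxA g1 -mulmxA gE mulmx1.
have h1 : mnorm r' < 1 by lra.
have [k [k1 _ _]] := bn_neumann (mnorm_banach_star n) h1.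
have {}k1 : (1%:M - r') *m k = 1%:M := k1.
have Fr : F *m r' = r' by rewrite mulmxBr FF mulmxA FV.
have VVF : madj V *m V = F *m (1%:M - r').
  by rewrite mulmxBr mulmx1 Fr /r' opprB addrC subrK.
have QV : madj W *m W *m madj V = madj V.
  have -> : madj W *m W *m madj V = madj V *m (g *m g) *m (V *m madj V).
    by rewrite WW !mulmxA.
  rewrite VV [E *m _]mulmxBr mulmx1 Er -rE -{1}[E]mul1mx -mulmxBl.
  have -> : madj V *m (g *m g) *m ((1%:M - r) *m E) =
      madj V *m (g *m (g *m (1%:M - r))) *m E by rewrite !mulmxA.
  by rewrite g1 [g *m (_ *m g)]mulmxA g1 -[(1%:M - r) *m g *m g]mulmxA gE mulmx1 sV.
have QF : madj W *m W *m F = madj W *m W by rewrite -mulmxA /W -!mulmxA VF.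
clearbody W.
have : madj W *m W *m (madj V *m V) = madj V *m V by rewrite mulmxA QV.
rewrite VVF => /(congr1 (mulmx^~ k)).
by rewrite mulmxA QF -[LHS]mulmxA -[RHS]mulmxA k1 !mulmx1.
Qed.

End MatrixNorm.

Section SpanMatrices.
Context {R : realType} {A : cstarAlgType R} {tau : A -> \bar R}.
Hypothesis tau_trace : is_trace tau.
Local Notation Ad := (unitization A).
Local Notation us := (unitz_span tau).

Lemma fst_mul (X Y : Ad) :
  (X * Y).1 = (emb X.1 * emb Y.1).1 + X.2 *: Y.1 + Y.2 *: X.1.
Proof. by rewrite /= !scale0r !addr0. Qed.

Lemma unitz_span0 : us 0.
Proof. exact: (span0 (tau := tau)). Qed.

Lemma unitz_spanD X Y : us X -> us Y -> us (X + Y).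
Proof. exact: (spanD tau_trace). Qed.

Lemma unitz_spanN X : us X -> us (- X).
Proof. exact: (spanN tau_trace). Qed.

Lemma unitz_span_sc z : us (sc z).
Proof. exact: (span0 (tau := tau)). Qed.

Lemma unitz_span_star X : us X -> us (star X).
Proof. exact: (span_star tau_trace). Qed.

Lemma unitz_spanM X Y : us X -> us Y -> us (X * Y).
Proof.
move=> sX sY; rewrite /unitz_span /mkset (fst_mul X Y).
have [h _ _] := span_ideal tau_trace (emb Y.1) sX.
exact: (spanD tau_trace (spanD tau_trace h (spanZ tau_trace _ sY)) (spanZ tau_trace _ sX)).
Qed.

(** [M_tau] is an ideal of the whole of [A^dagger], not only of
    [M_tau^dagger]. *)
Lemma unitz_span_ideal X Y : us X -> X.2 = 0 -> us (X * Y) /\ us (Y * X).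
Proof.
by move=> sX X0; have [] := span_ideal tau_trace Y sX; rewrite embK.
Qed.

Lemma unitz_traceC X Y : us X -> us Y ->
  unitz_trace tau (X * Y) = unitz_trace tau (Y * X).
Proof.
move=> sX sY; rewrite /unitz_trace (fst_mul X Y) (fst_mul Y X).
have [h1 h2 h3] := span_ideal tau_trace (emb Y.1) sX.
have hX := spanZ tau_trace Y.2 sX; have hY := spanZ tau_trace X.2 sY.
rewrite (ltauD tau_trace (spanD tau_trace h1 hY) hX) (ltauD tau_trace h1 hY).
rewrite (ltauD tau_trace (spanD tau_trace h2 hX) hY) (ltauD tau_trace h2 hX) h3.
exact: addrAC.
Qed.

Lemma unitz_trace_sum (I : finType) (F : I -> Ad) : (forall i, us (F i)) ->
  us (\sum_i F i) /\
  unitz_trace tau (\sum_i F i) = \sum_i unitz_trace tau (F i).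
Proof.
move=> sF; elim/big_ind2 : _ => [|X u Y v [sX <-] [sY <-]|i _]; last by [].
  by split; [exact: unitz_span0|exact: (ltau0 tau_trace)].
by split; [exact: unitz_spanD|exact: (ltauD tau_trace)].
Qed.

(** [mx_over_span] for rectangular matrices. *)
Definition mxspan m n (X : 'M[Ad]_(m, n)) : Prop := forall i j, us (X i j).

(** Matrices over [A], inside those over its unitization. *)
Definition malg m n (X : 'M[Ad]_(m, n)) : Prop := forall i j, (X i j).2 = 0.

Lemma mxspanD m n (X Y : 'M[Ad]_(m, n)) : mxspan X -> mxspan Y -> mxspan (X + Y).
Proof. by move=> sX sY i j; rewrite mxE; exact: unitz_spanD. Qed.

Lemma mxspanN m n (X : 'M[Ad]_(m, n)) : mxspan X -> mxspan (- X).
Proof. by move=> sX i j; rewrite mxE; exact: unitz_spanN. Qed.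

Lemma mxspan_madj m n (X : 'M[Ad]_(m, n)) : mxspan X -> mxspan (madj X).
Proof. by move=> sX i j; rewrite !mxE; exact: unitz_span_star. Qed.

Lemma mxspan_scalar n z : mxspan ((sc z)%:M : 'M[Ad]_n).
Proof.
move=> i j; rewrite mxE; case: (i == j); [exact: unitz_span_sc|exact: unitz_span0].
Qed.

Lemma mxspanM m n k (X : 'M[Ad]_(m, n)) (Y : 'M[Ad]_(n, k)) :
  mxspan X -> mxspan Y -> mxspan (X *m Y).
Proof.
move=> sX sY i j; rewrite mxE.
have h l : us (X i l * Y l j) by exact: unitz_spanM.
by have [] := unitz_trace_sum h.
Qed.

Lemma mxspan_idealr m n k (X : 'M[Ad]_(m, n)) (Y : 'M[Ad]_(n, k)) :
  mxspan X -> malg X -> mxspan (X *m Y).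
Proof.
move=> sX aX i j; rewrite mxE.
have h l : us (X i l * Y l j) := (unitz_span_ideal _ (sX i l) (aX i l)).1.
by have [] := unitz_trace_sum h.
Qed.

Lemma malgD m n (X Y : 'M[Ad]_(m, n)) : malg X -> malg Y -> malg (X + Y).
Proof. by move=> aX aY i j; rewrite mxE /= aX aY addr0. Qed.

Lemma malgN m n (X : 'M[Ad]_(m, n)) : malg X -> malg (- X).
Proof. by move=> aX i j; rewrite mxE /= aX oppr0. Qed.

Lemma malg_madj m n (X : 'M[Ad]_(m, n)) : malg X -> malg (madj X).
Proof. by move=> aX i j; rewrite !mxE /= aX conjc0. Qed.

Lemma snd_sum (I : finType) (F : I -> Ad) : (\sum_i F i).2 = \sum_i (F i).2.
Proof. by elim/big_ind2 : _ => // X u Y v <- <-. Qed.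

Lemma malgMr m n k (X : 'M[Ad]_(m, n)) (Y : 'M[Ad]_(n, k)) :
  malg X -> malg (X *m Y).
Proof.
by move=> aX i j; rewrite mxE snd_sum big1// => l _; rewrite sndM aX mul0r.
Qed.

Lemma malgMl m n k (X : 'M[Ad]_(m, n)) (Y : 'M[Ad]_(n, k)) :
  malg Y -> malg (X *m Y).
Proof.
by move=> aY i j; rewrite mxE snd_sum big1// => l _; rewrite sndM aY mulr0.
Qed.

Lemma unitz_trace_mxC m n (X : 'M[Ad]_(m, n)) (Y : 'M[Ad]_(n, m)) :
  mxspan X -> mxspan Y ->
  unitz_trace_mx tau (X *m Y) = unitz_trace_mx tau (Y *m X).
Proof.
move=> sX sY; rewrite /unitz_trace_mx.
have hX i j k l : us (X i j * Y k l) by exact: unitz_spanM.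
have hY i j k l : us (Y i j * X k l) by exact: unitz_spanM.
under eq_bigr => i _ do rewrite mxE (unitz_trace_sum (fun=> hX _ _ _ _)).2.
under [RHS]eq_bigr => i _ do rewrite mxE (unitz_trace_sum (fun=> hY _ _ _ _)).2.
rewrite exchange_big; apply: eq_bigr => i _; apply: eq_bigr => j _.
exact: unitz_traceC.
Qed.

Lemma unitz_trace_mx_dsum m n (X : 'M[Ad]_m) (Y : 'M[Ad]_n) :
  unitz_trace_mx tau (dsum X Y) = unitz_trace_mx tau X + unitz_trace_mx tau Y.
Proof.
rewrite /unitz_trace_mx big_split_ord /=; congr (_ + _).
  by apply: eq_bigr => i _; rewrite block_mxEul.
by apply: eq_bigr => i _; rewrite block_mxEdr.
Qed.

Lemma mxspan_dsum m n (X : 'M[Ad]_m) (Y : 'M[Ad]_n) :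
  mxspan X -> mxspan Y -> mxspan (dsum X Y).
Proof.
move=> sX sY i j; rewrite /dsum !mxE.
by case: (fintype.split i) => k; rewrite mxE; case: (fintype.split j) => l;
  rewrite ?mxE //; exact: unitz_span0.
Qed.

Lemma unitz_trace_mx_real n (e : 'M[Ad]_n) : is_proj e -> mxspan e ->
  unitz_trace_mx tau e = (complex.Re (unitz_trace_mx tau e))%:C.
Proof.
move=> /andP[_ /eqP es] se.
have : conjc (unitz_trace_mx tau e) = unitz_trace_mx tau e.
  rewrite /unitz_trace_mx (rmorph_sum (@conjc R)); apply: eq_bigr => i _.
  by rewrite -[in RHS]es !mxE; exact/esym/(ltau_star tau_trace (se i i)).
case: (unitz_trace_mx tau e) => a b [] /= h.
by apply/eqP; rewrite eq_complex /= eqxx /=; apply/eqP; lra.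
Qed.

Hypothesis tau_dense : densely_defined tau.

(** The approximation keeps the scalar parts, so that the error lies in the
    ideal of matrices over [A]. *)
Lemma mxspan_dense m n (w : 'M[Ad]_(m, n)) e : 0 < e ->
  exists x, [/\ mxspan x, malg (x - w) & mnorm (x - w) <= e].
Proof.
move=> e0; pose c := e / (m * n).+1%:R; have c0 : 0 < c by rewrite divr_gt0.
have [y hy] := choice (fun ij : 'I_m * 'I_n =>
  span_dense tau_trace tau_dense (w ij.1 ij.2).1 c0).
exists (\matrix_(i, j) (y (i, j), (w i j).2)); split.
- by move=> i j; rewrite mxE; exact: (hy (i, j)).1.
- by move=> i j; rewrite !mxE /= subrr.
have -> : e = (m * n).+1%:R * c by rewrite mulrC divfK// pnatr_eq0.
rewrite /mnorm.
apply: le_trans (_ : \sum_(i < m) \sum_(j < n) c <= _).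
  apply: ler_sum => i _; apply: ler_sum => j _; rewrite !mxE.
  apply: le_trans (unorm_le _) _; rewrite /= subrr nm_0 addr0.
  by have := (hy (i, j)).2; rewrite -nm_N opprB => /ltW.
rewrite !sumr_const !card_ord -mulrnA -[c *+ _]mulr_natl mulnC.
by rewrite ler_wpM2r ?ltW// ltr_nat.
Qed.

End SpanMatrices.

(** * Projections over the ideal of definition *)

Section Compression.
Context {R : realType} {A : cstarAlgType R}.
Local Notation Ad := (unitization A).

Lemma mnorm_compression n (b a : 'M[Ad]_n) (K e : R) : 0 <= K -> 0 <= e ->
  mnorm b <= K -> mnorm a <= e -> mnorm (b *m a *m b) <= K * e * K.
Proof.
move=> K0 e0 bK ae; apply: le_trans (mnormM _ _) _.
rewrite ler_pM ?mnorm_ge0//; apply: le_trans (mnormM _ _) _.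
by rewrite ler_pM ?mnorm_ge0.
Qed.

Lemma compression_defectE m n (E : 'M[Ad]_m) (F : 'M[Ad]_n) (u v : 'M[Ad]_(m, n)) :
  E *m (u *m F *m madj u) *m E = E ->
  E - E *m (v *m F *m madj v) *m E =
    - (E *m ((v - u) *m F *m madj u + v *m F *m madj (v - u)) *m E).
Proof.
move=> uE.
have -> : v *m F *m madj v = u *m F *m madj u +
    ((v - u) *m F *m madj u + v *m F *m madj (v - u)).
  rewrite !mulmxBl addrA [u *m F *m madj u + _]addrC subrK.
  by rewrite madjD madjN mulmxDr mulmxN addrC subrK.
by rewrite [E *m (_ + _)]mulmxDr mulmxDl uE opprD addrA subrr sub0r.
Qed.

(** The defect vanishes at [v = u], so it is small for [v] near [u]. *)
Lemma mnorm_compression_defect m n (E : 'M[Ad]_m) (F : 'M[Ad]_n)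
    (u v : 'M[Ad]_(m, n)) (K d : R) :
  1 <= K -> 0 <= d -> d <= 1 ->
  mnorm E <= K -> mnorm F <= K -> mnorm u <= K -> mnorm (v - u) <= d ->
  E *m (u *m F *m madj u) *m E = E ->
  mnorm (E - E *m (v *m F *m madj v) *m E) <= 3 * (d * K ^+ 4).
Proof.
move=> K1 d0 d1 EK FK uK vu /compression_defectE ->; rewrite mnormN.
have K0 : 0 <= K := le_trans ler01 K1.
have vK : mnorm v <= K + 1.
  rewrite -[v](subrK u) addrC; apply: le_trans (mnormD _ _) _.
  by rewrite lerD// (le_trans vu).
have h1 : mnorm ((v - u) *m F *m madj u) <= d * K * K.
  apply: le_trans (mnormM _ _) _; rewrite mnorm_madj ler_pM ?mnorm_ge0//.
  by apply: le_trans (mnormM _ _) _; rewrite ler_pM ?mnorm_ge0.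
have h2 : mnorm (v *m F *m madj (v - u)) <= (K + 1) * K * d.
  apply: le_trans (mnormM _ _) _; rewrite mnorm_madj ler_pM ?mnorm_ge0//.
  by apply: le_trans (mnormM _ _) _; rewrite ler_pM ?mnorm_ge0.
have h3 : d * K * K + (K + 1) * K * d <= 3 * (d * (K * K)).
  have : d * K <= d * K * K := ler_peMr (mulr_ge0 d0 K0) K1.
  by clear; lra.
have -> : 3 * (d * K ^+ 4) = K * (3 * (d * (K * K))) * K by ring.
apply: mnorm_compression => //; first by rewrite !mulr_ge0.
exact: le_trans (mnormD _ _) (le_trans (lerD h1 h2) h3).
Qed.

End Compression.

Section Projections.
Context {R : realType} {A : cstarAlgType R} {tau : A -> \bar R}.
Hypotheses (tau_trace : is_trace tau) (tau_dense : densely_defined tau).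
Local Notation Ad := (unitization A).
Local Notation mxspan := (mxspan (tau := tau)).

(** An approximation [y] of [p] with the same scalar part has [y - y^2] over
    [M_tau], so the projection near [y] stays over [M_tau^dagger]. Nearby
    projections [p] and [q] are equivalent by the polar part of [p q]. *)
Lemma projection_mvn_span n (p : 'M[Ad]_n) : is_proj p ->
  exists q, [/\ is_proj q, mxspan q &
    exists W : 'M[Ad]_n, W *m madj W = p /\ madj W *m W = q].
Proof.
move=> pP; have /andP[/eqP pp /eqP ps] := pP.
have NB := mnorm_banach_star (A := A) n.
pose K := mnorm p + 1; have p0 := mnorm_ge0 p.
have K1 : 1 <= K by rewrite /K; lra.
have K0 : 0 < K by lra.
have K2 : 0 < K * K by rewrite mulr_gt0.
pose e := Num.min 1 (1 / (4 * (K * K))).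
have e0 : 0 < e by rewrite lt_min ltr01 /= divr_gt0// mulr_gt0.
have e1 : e <= 1 by rewrite ge_min lexx.
have eK : K * K * e <= 1 / 4.
  have : e <= 1 / (4 * (K * K)) by rewrite ge_min lexx orbT.
  rewrite ler_pdivlMr ?mulr_gt0//; lra.
have [d [d0 hd]] := bn_projection_near NB (pp : p * p = p) e0.
have [x [sx ax xN]] := mxspan_dense tau_trace tau_dense p d0.
pose h : 'M[Ad]_n := uhalf%:M.
pose y := h * (x + madj x).
have hC (v : 'M[Ad]_n) : h * v = v * h := bn_halfC NB v.
have hh : h + h = 1 := bn_halfE NB.
have hs : madj h = h := bn_star_half NB.
have ys : madj y = y.
  rewrite /y -[h * _]/(h *m _) madjM madjD madjK hs [madj x + x]addrC.
  by rewrite -[_ *m h]/(_ * h) -hC.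
have yp : y - p = h * ((x - p) + madj (x - p)).
  by rewrite madjD madjN ps half_symmetrization.
have yN : mnorm (y - p) <= d.
  rewrite yp (bn_half NB); have := mnormD (x - p) (madj (x - p)).
  rewrite mnorm_madj; lra.
have ay : malg (y - p).
  by rewrite yp; apply: malgMl; apply: malgD => //; exact: malg_madj.
have sh : mxspan h by exact: mxspan_scalar.
have sy : mxspan y.
  by apply: mxspanM => //; apply: mxspanD => //; exact: mxspan_madj.
have [z] := hd y ys yN.
set w := (y - y * y) + _ + _ => /= -[].
set q := y + (y - _) * (w * z) => qq qs qN.
(* The scalar part of [y] is that of [p], hence idempotent. *)
have ayy : malg (y - y * y).
  rewrite (sub_sqr_near_idempotent y (pp : p * p = p)).
  have ayp := malgD ay (malgN (malgMl p ay)).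
  exact: (malgD (malgD ayp (malgN (malgMr p ay))) (malgN (malgMr (y - p) ay))).
have aw : malg w := malgD (malgD ayy ayy) (malgD ayy ayy).
have syy : mxspan (y - y * y).
  by apply: mxspanD => //; apply: mxspanN => //; exact: mxspanM.
have sw : mxspan w by apply: mxspanD => //; exact: mxspanD.
have sq : mxspan q.
  apply: mxspanD => //; apply: mxspanM => //.
    by apply: mxspanD => //; apply: mxspanN => //; exact: sh.
  exact: mxspan_idealr.
have qP : is_proj q by rewrite /is_proj -[q *m q]/(q * q) qq qs !eqxx.
exists q; split=> //.
pose V := p *m q.
have q1 : mnorm q <= K.
  rewrite -[q](subrK p); apply: le_trans (mnormD _ _) _.
  by rewrite /K addrC lerD2l; exact: le_trans qN e1.
have pV : p *m V = V by rewrite /V mulmxA pp.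
have Vq : V *m q = V by rewrite /V -mulmxA -[q *m q]/(q * q) qq.
have Vs : madj V = q *m p by rewrite madjM ps qs.
have qq' : q *m q = q := qq.
have r1 : mnorm (p - V *m madj V) <= 1 / 4.
  have -> : p - V *m madj V = p *m (p - q) *m p.
    by rewrite Vs /V mulmxBr mulmxBl !pp -!mulmxA (mulmxA q q) qq'.
  apply: le_trans eK; rewrite mulrAC; apply: (mnorm_compression (ltW K0) (ltW e0)).
    by rewrite /K lerDl.
  by rewrite -mnormN opprB.
have r2 : mnorm (q - madj V *m V) <= 1 / 4.
  have -> : q - madj V *m V = q *m (q - p) *m q.
    by rewrite Vs /V mulmxBr mulmxBl !qq' -!mulmxA (mulmxA p p) pp.
  by apply: le_trans eK; rewrite mulrAC; exact: (mnorm_compression (ltW K0) (ltW e0)).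
have [k [h1 h2]] := polar pP qP pV Vq r1 r2.
by exists ((1%:M + (p - V *m madj V) *m k) *m V).
Qed.

(** [w] itself need not have entries in [M_tau^dagger], but the polar part of
    [e x f] does when [x] does: [e - V V^*] is over [M_tau] since [x] and [w]
    have the same scalar part. *)
Lemma unitz_trace_mx_mvn m n (e : 'M[Ad]_m) (f : 'M[Ad]_n) (w : 'M[Ad]_(m, n)) :
  is_proj e -> is_proj f -> mxspan e -> mxspan f ->
  w *m madj w = e -> madj w *m w = f ->
  unitz_trace_mx tau e = unitz_trace_mx tau f.
Proof.
move=> eP fP se sf we wf.
have /andP[/eqP ee /eqP es] := eP; have /andP[/eqP ff /eqP fs] := fP.
pose K := mnorm e + mnorm f + mnorm w + 1.
have e0 := mnorm_ge0 e; have f0 := mnorm_ge0 f; have w0 := mnorm_ge0 w.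
have K1 : 1 <= K by rewrite /K; lra.
have [eK fK wK] : [/\ mnorm e <= K, mnorm f <= K & mnorm w <= K].
  by rewrite /K; split; lra.
clearbody K.
have K4 : 1 <= K ^+ 4 by rewrite exprn_ege1.
(* The bound of [mnorm_compression_defect] becomes one quarter. *)
pose d := 1 / (12 * K ^+ 4).
have d0 : 0 < d by rewrite divr_gt0//; lra.
have dK12 : d * K ^+ 4 = 1 / 12.
  by rewrite /d mul1r invfM -mulrA mulVf ?mulr1 ?mul1r//; apply: lt0r_neq0; lra.
have dK : 3 * (d * K ^+ 4) <= 1 / 4 by rewrite dK12; lra.
have d1 : d <= 1.
  by have : d <= d * K ^+ 4 by [rewrite ler_peMr// ltW]; rewrite dK12; lra.
clearbody d.
have [x [sx ax xN]] := mxspan_dense tau_trace tau_dense w d0.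
have eE : e *m (w *m f *m madj w) *m e = e.
  have -> : w *m f *m madj w = e by rewrite -wf !mulmxA we -mulmxA we ee.
  by rewrite !ee.
have fE : f *m (madj w *m e *m madj (madj w)) *m f = f.
  rewrite madjK.
  have -> : madj w *m e *m w = f by rewrite -we !mulmxA wf -mulmxA wf ff.
  by rewrite !ff.
pose V := e *m x *m f.
have Vs : madj V = f *m madj x *m e by rewrite !madjM es fs mulmxA.
have eV : e *m V = V by rewrite /V !mulmxA ee.
have Vf : V *m f = V by rewrite /V -mulmxA ff.
have VV : V *m madj V = e *m (x *m f *m madj x) *m e.
  by rewrite Vs /V !mulmxA -(mulmxA (e *m x)) ff.
have VV' : madj V *m V = f *m (madj x *m e *m madj (madj x)) *m f.
  by rewrite Vs /V madjK !mulmxA -(mulmxA (f *m madj x) e e) ee.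
have r1 : mnorm (e - V *m madj V) <= 1 / 4.
  by rewrite VV; apply: le_trans (mnorm_compression_defect K1 (ltW d0) d1 eK fK wK xN eE) dK.
have r2 : mnorm (f - madj V *m V) <= 1 / 4.
  rewrite VV'; apply: le_trans (mnorm_compression_defect K1 (ltW d0) d1 fK eK _ _ fE) dK.
    by rewrite mnorm_madj.
  by rewrite -madjN -madjD mnorm_madj.
have [z [h1 h2]] := polar eP fP eV Vf r1 r2.
rewrite -h1 -h2.
have sV : mxspan V by do 2!apply: mxspanM => //.
have sr : mxspan (e - V *m madj V).
  by apply: mxspanD => //; apply: mxspanN => //; apply: mxspanM => //; exact: mxspan_madj.
have ar : malg (e - V *m madj V).
  rewrite VV (compression_defectE _ eE); apply/malgN/malgMr/malgMl/malgD.
    by do 2!apply: malgMr.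
  by apply/malgMl/malg_madj.
have sW : mxspan ((1%:M + (e - V *m madj V) *m z) *m V).
  apply: mxspanM => //; apply: mxspanD => //; first exact: (mxspan_scalar 1).
  exact: mxspan_idealr.
by apply: unitz_trace_mxC => //; exact: mxspan_madj.
Qed.

End Projections.

(** * The homomorphism on K_0 *)

Section TraceOnK0.
Context {R : realType} {A : cstarAlgType R} {tau : A -> \bar R}.
Hypotheses (tau_trace : is_trace tau) (tau_dense : densely_defined tau).
Local Notation Ad := (unitization A).
Local Open Scope quotient_scope.

Lemma mvn_class_Pinfty (c : mvn_classes Ad) :
  exists x, Pinfty tau x /\ \pi_(mvn_classes Ad) x = c.
Proof.
elim/quotW: c => x.
have [q [qP sq [W [W1 W2]]]] := projection_mvn_span tau_trace tau_dense (proj_mxP x).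
exists (Projection qP); split; first exact: sq.
apply/esym/eqmodP; change (is_true (proj_mvn x (Projection qP))).
by apply/proj_mvnP; exists W.
Qed.

Definition Pinfty_repr (c : mvn_classes Ad) : projections Ad :=
  xget proj_zero [set x | Pinfty tau x /\ \pi_(mvn_classes Ad) x = c].

Lemma Pinfty_reprP c :
  Pinfty tau (Pinfty_repr c) /\ \pi_(mvn_classes Ad) (Pinfty_repr c) = c.
Proof. exact: (xgetPex proj_zero (mvn_class_Pinfty c)). Qed.

(** [unitz_trace_mx] is meaningful over [M_tau^dagger] only, so a class is
    measured on a representative there; the trace of a projection is real. *)
Definition class_trace (c : mvn_classes Ad) : R :=
  complex.Re (unitz_trace_mx tau (proj_mx (Pinfty_repr c))).

Lemma class_traceE x : Pinfty tau x ->
  (class_trace (\pi_(mvn_classes Ad) x))%:C = unitz_trace_mx tau (proj_mx x).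
Proof.
move=> sx; have [sy /eqmodP/proj_mvnP[w [w1 w2]]] := Pinfty_reprP (\pi_(mvn_classes Ad) x).
rewrite -(unitz_trace_mx_real tau_trace (proj_mxP _) sy).
exact: (unitz_trace_mx_mvn tau_trace tau_dense (proj_mxP _) (proj_mxP _) sy sx w1 w2).
Qed.

Lemma class_traceD c d : class_trace (c + d) = class_trace c + class_trace d.
Proof.
have [sc ec] := Pinfty_reprP c; have [sd ed] := Pinfty_reprP d.
apply: complexI; rewrite rmorphD /= -[in LHS]ec -[in LHS]ed.
rewrite -[_ + _ in LHS]/(mvn_add _ _) mvn_addE class_traceE; last first.
  exact: (mxspan_dsum sc sd).
rewrite unitz_trace_mx_dsum -[in RHS]ec -[in RHS]ed.
by rewrite !class_traceE.
Qed.

Definition K0_trace (g : K0 Ad) : R :=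
  class_trace (repr g).1 - class_trace (repr g).2.

(** Here the cancellation built into the Grothendieck relation meets the
    cancellation law of [R]. *)
Lemma K0_traceE (a b : mvn_classes Ad) :
  K0_trace (\pi_(grothendieck (mvn_classes Ad)) (a, b)) = class_trace a - class_trace b.
Proof.
have /eqmodP/asboolP[c] := reprK (\pi_(grothendieck (mvn_classes Ad)) (a, b)).
move=> /(congr1 class_trace); rewrite !class_traceD => /addIr /= h.
by apply/eqP; rewrite /K0_trace subr_eq addrAC -h addrK.
Qed.

Lemma groth_pair (a b : mvn_classes Ad) :
  \pi_(grothendieck (mvn_classes Ad)) (a, b) = groth_class a - groth_class b.
Proof.
rewrite /groth_class -[- _]/(groth_opp _) groth_oppE -[_ + _]/(groth_add _ _) groth_addE.
by congr (\pi _); congr pair; rewrite /= ?addr0 ?add0r.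
Qed.

Lemma K0_trace_is_additive : {morph K0_trace : x y / x - y}.
Proof.
elim/quotW => -[a b]; elim/quotW => -[a' b'].
have -> : \pi_(grothendieck (mvn_classes Ad)) (a, b) -
      \pi_(grothendieck (mvn_classes Ad)) (a', b') =
    \pi_(grothendieck (mvn_classes Ad)) (a + b', b + a').
  by rewrite -[- _]/(groth_opp _) groth_oppE -[LHS]/(groth_add _ _) groth_addE.
rewrite !K0_traceE !class_traceD opprB opprD.
exact: addrACA.
Qed.


End TraceOnK0.

Theorem theorem4p2 (R : realType) (A : cstarAlgType R) (tau : A -> \bar R)
    (tau_trace : is_trace tau) (tau_dense : densely_defined tau) :
  [set: K0 (unitization A)] =
    [set K0_class e - K0_class f | e in Pinfty tau & f in Pinfty tau]
  /\
  exists tau_K0 : {additive K0 (unitization A) -> R},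
    forall (n : nat) (e f : 'M[unitization A]_n)
        (e_proj : is_proj e) (f_proj : is_proj f),
      mx_over_span tau e -> mx_over_span tau f ->
      (tau_K0 (K0_class (Projection e_proj) - K0_class (Projection f_proj)))%:C
      = unitz_trace_mx tau e - unitz_trace_mx tau f.
Proof.
split.
  apply/esym; rewrite -subTset => g _; elim/quotW: g => -[a b].
  have [e [se ea]] := mvn_class_Pinfty tau_trace tau_dense a.
  have [f [sf fb]] := mvn_class_Pinfty tau_trace tau_dense b.
  by exists e => //; exists f => //; rewrite groth_pair -ea -fb.
pose K0_trace_morphism := GRing.isZmodMorphism.Build _ _ _
  (K0_trace_is_additive tau_trace tau_dense).
pose tau_K0 : {additive K0 (unitization A) -> R} :=
  HB.pack (K0_trace (tau := tau)) K0_trace_morphism.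
exists tau_K0.
move=> n e f eP fP se sf /=.
rewrite /K0_class -groth_pair K0_traceE // rmorphB /=.
by rewrite !class_traceE.
Qed.
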